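(* There is an absolute constant $K>0$ such that the following holds for every $\epsilon\in(0,1)$. Let $P(X)=\sum_{i=1}^mA_i(X)B_i(X)$ be a polynomial in $X=(X_1,\dots,X_n)$, where each $A_i,B_i$ is a quadratic form with $0\preceq A_i\preceq\|X\|^2$, $B_i\succeq0$ and $\sum_iB_i\preceq\|X\|^2$. Let $\|P\|=\max_{\|x\|=1}|P(x)|$ and $d\ge K\log n/\epsilon^2$. (1) Every level-$d$ pseudoexpectation $\tilde{\mathbb{E}}$ over $X$ satisfying $\tilde{\mathbb{E}}[(\|X\|^2-1)Q]=0$ for all polynomials $Q$ of degree at most $d-2$ has $\tilde{\mathbb{E}}P(X)\le3\|P\|+\epsilon$. (2) If moreover $X=(Y,Z)$ with the $A_i$ depending only on $Y$ and the $B_i$ depending only on $Z$, then every level-$d$ pseudoexpectation $\tilde{\mathbb{E}}$ satisfying $\tilde{\mathbb{E}}[(\|Y\|^2-\tfrac12)Q]=\tilde{\mathbb{E}}[(\|Z\|^2-\tfrac12)Q]=0$ for all polynomials $Q$ of degree at most $d-2$ has $\tilde{\mathbb{E}}P(X)\le\|P\|+\epsilon$.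
   Context: $\|x\|$ is the Euclidean norm. For polynomials $P,Q$, $P\preceq Q$ means $Q-P$ is a sum of squares of polynomials; for quadratic forms this is equivalent to the corresponding symmetric matrices satisfying the PSD (Loewner) order, so e.g. $A_i\preceq\|X\|^2$ means the matrix of $A_i$ is $\preceq I$. A level-$d$ pseudoexpectation over $X$ is a linear functional on real polynomials of degree at most $d$ in $X$ with $\tilde{\mathbb{E}}1=1$ and $\tilde{\mathbb{E}}Q^2\ge0$ whenever $\deg Q\le d/2$. *)

(* Defs.v *)
From Stdlib Require Export Reals List Arith.
Export ListNotations.
Open Scope R_scope.

(* A monomial in X_0, X_1, ... : exponent vector (variable index -> exponent). *)
Definition mono := nat -> nat.
Definition mone : mono := fun _ => 0%nat.
Definition mmul (a b : mono) : mono := fun i => (a i + b i)%nat.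

(* A polynomial as a formal sum  sum_t (fst t) * X^(snd t). *)
Definition poly := list (R * mono).

Definition pconst (c : R) : poly := [(c, mone)].
Definition pvar (i : nat) : poly := [(1, fun j => if Nat.eqb j i then 1%nat else 0%nat)].
Definition padd (p q : poly) : poly := p ++ q.
Definition pscale (c : R) (p : poly) : poly := map (fun t => (c * fst t, snd t)) p.
Definition psub (p q : poly) : poly := padd p (pscale (-1) q).
Definition pmul (p q : poly) : poly :=
  flat_map (fun t => map (fun s => (fst t * fst s, mmul (snd t) (snd s))) q) p.
Definition psum_from (a k : nat) (f : nat -> poly) : poly := flat_map f (seq a k).
Definition psum (k : nat) (f : nat -> poly) : poly := psum_from 0 k f.

Definition sumR (k : nat) (f : nat -> R) : R := fold_right Rplus 0 (map f (seq 0 k)).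

Definition mdeg (n : nat) (a : mono) : nat := fold_right plus 0%nat (map a (seq 0 n)).
Definition mono_in (n : nat) (a : mono) : Prop := forall i, (n <= i)%nat -> a i = 0%nat.
Definition poly_deg_le (n k : nat) (p : poly) : Prop :=
  Forall (fun t => mono_in n (snd t) /\ (mdeg n (snd t) <= k)%nat) p.

Definition peval (n : nat) (p : poly) (x : nat -> R) : R :=
  fold_right Rplus 0
    (map (fun t => fst t * fold_right Rmult 1 (map (fun i => x i ^ (snd t i)) (seq 0 n))) p).

(* A linear functional on polynomials, given by its values on monomials. *)
Definition pE (L : mono -> R) (p : poly) : R :=
  fold_right Rplus 0 (map (fun t => fst t * L (snd t)) p).

(* Level-d pseudoexpectation over X = (X_0..X_{n-1}): linear functional on
   polynomials of degree <= d (determined by the moments L a, deg a <= d), with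
   E 1 = 1 and E Q^2 >= 0 whenever deg Q <= d/2. *)
Definition is_pseudoexp (n d : nat) (L : mono -> R) : Prop :=
  L mone = 1 /\
  forall Q, poly_deg_le n (Nat.div d 2) Q -> 0 <= pE L (pmul Q Q).

Definition sqnorm_from (a k : nat) : poly := psum_from a k (fun i => pmul (pvar i) (pvar i)).
Definition sqnorm (n : nat) : poly := sqnorm_from 0 n.

Definition quad (n : nat) (M : nat -> nat -> R) : poly :=
  psum n (fun j => psum n (fun k => pscale (M j k) (pmul (pvar j) (pvar k)))).
Definition qf (n : nat) (M : nat -> nat -> R) (v : nat -> R) : R :=
  sumR n (fun j => sumR n (fun k => M j k * v j * v k)).
Definition sqn (n : nat) (v : nat -> R) : R := sumR n (fun i => v i * v i).

Definition Ppoly (n m : nat) (A B : nat -> nat -> nat -> R) : poly :=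
  psum m (fun i => pmul (quad n (A i)) (quad n (B i))).

(* Main.v *)
(* Complete the B_i to a measurement summing to a multiple of ||X||^2 (of ||Z||^2 in (2)) and
   condition the pseudoexpectation k ~ d/2 times on its outcomes, that is, multiply it by
   B_i1 ... B_ik. Normalise its matrix of second moments to a density matrix. On average the
   von Neumann entropy of this matrix drops at every step by the information gained about X,
   and the total drop is at most log n, whatever the dimension of the measurement.
   Pinsker's inequality then shows that in the average step tr(A_i rho) hardly depends on the
   outcome i, so that E P is within O(sqrt(log n / k)) of the average of
   sum_i tr(A_i rho) tr(B_i rho).
   The latter is compared with ||P|| by writing rho = sum v v^T: in (2) one evaluates P at pairs
   (v_Y, w_Z), in (1) at a random signed sum of the vectors v, whose fourth moment
   E ||x||^4 <= 3 (tr rho)^2 is the source of the factor 3. *)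
From mathcomp Require ssreflect ssrfun ssrbool eqtype ssrnat seq choice fintype bigop order ssralg ssrnum matrix sesquilinear spectral complex Rstruct.
Require Import Defs.
From Stdlib Require Import Reals List Arith Lra Lia FunctionalExtensionality.
Open Scope R_scope.

(** * Real eigenframes of symmetric matrices *)

(** Conditioned functionals are never normalised: the value at 1 is the probability of the outcomes
    so far, [value] and [potential] scale linearly with the functional, and averages over outcomes
    become plain sums. The price is a separate treatment of outcomes of probability zero. Pinsker's
    inequality is used in the linearised form tr(A(rho - sigma)) <= th + (2 / th) * divergence, with
    [th] free, so that it can be added over outcomes and steps without any square root. The sum
    telescopes because the cross term of the divergence is linear in the posterior and the
    posteriors sum to the prior: the divergences of one step add up to exactly the drop of entropy.
    No matrix logarithm is formed; entropies are sums over eigenvectors, and mixing with 1/n keeps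
    every logarithm finite while doubling the trace. After k steps the error is th + 4 ln n / (th
    k), which is balanced by taking th proportional to eps. *)

Module Spectral.
Import ssreflect ssrfun ssrbool eqtype ssrnat seq choice fintype bigop order ssralg ssrnum matrix sesquilinear spectral complex Rstruct.
Import Order.TTheory GRing.Theory Num.Theory.
Local Open Scope ring_scope.
Local Open Scope complex_scope.
Local Open Scope sesquilinear_scope.

Lemma big_sumR n (f : nat -> R) : \sum_(i < n) f i = sumR n f.
Proof.
rewrite /sumR -(big_mkord xpredT f) /index_iota subn0.
have -> : iota 0 n = List.seq 0 n by elim: n 0%N => [|n IH] s //=; rewrite IH.
elim: (List.seq 0 n) => [|i s IH] /=; first by rewrite big_nil.
by rewrite big_cons IH.
Qed.

Lemma Re_sum n (f : 'I_n -> R[i]) : \sum_(i < n) complex.Re (f i) = complex.Re (\sum_(i < n) f i).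
Proof. by elim/big_rec2: _ => //= i y1 y2 _ ->; case: (f i) y1 => [a b] [c d]. Qed.

Lemma Im_sum n (f : 'I_n -> R[i]) : \sum_(i < n) complex.Im (f i) = complex.Im (\sum_(i < n) f i).
Proof. by elim/big_rec2: _ => //= i y1 y2 _ ->; case: (f i) y1 => [a b] [c d]. Qed.

(* The real and imaginary parts of a unitary eigenbasis of the complexified matrix form
   a tight frame of 2n real eigenvectors, which replaces an orthonormal basis throughout. *)
Lemma symmetric_eigenframe n (A : 'M[R]_n) : A^T = A ->
  exists (a : nat -> R) (x y : nat -> nat -> R),
  (forall j k : 'I_n, \sum_(r < n) (x r j * x r k + y r j * y r k) = (j == k)%:R) /\
  (forall r j : 'I_n, \sum_(k < n) A j k * x r k = a r * x r j /\
                 \sum_(k < n) A j k * y r k = a r * y r j).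
Proof.
move=> Asym.
pose B := map_mx (real_complex R) A.
have Bh : B \is hermsymmx.
  apply: realsym_hermsym.
    by apply/is_hermitianmxP; rewrite expr0 scale1r map_mx_id // map_trmx Asym.
  by apply/mxOverP => i j; rewrite mxE complex_real.
have Dr := hermitian_spectral_diag_real Bh.
have /orthomx_spectralP := hermitian_normalmx Bh.
have Pu := spectral_unitarymx B.
rewrite invmx_unitary //.
set P := spectralmx B; set D := spectral_diag B => E.
have PP : P^t* *m P = 1%:M.
  by rewrite -(invmx_unitary Pu) mulVmx // spectral_unit.
have PP' : P *m P^t* = 1%:M by apply/unitarymxP.
have E2 : B *m P^t* = P^t* *m diag_mx D.
  by rewrite {1}E -!mulmxA PP' mulmx1.
(* Entries become functions on [nat], with default 0 outside the range of the ordinals. *)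
pose g (f : R[i] -> R) (r j : nat) := oapp (fun r' : 'I_n => oapp (fun j' => f (P r' j')) 0 (insub j)) 0 (insub r : option 'I_n).
have gE f (r j : 'I_n) : g f r j = f (P r j) by rewrite /g !valK.
exists (fun r => oapp (fun r' : 'I_n => complex.Re (D ord0 r')) 0 (insub r)), (g (@complex.Re R)), (g (@complex.Im R)).
split=> [j k|r j].
  have := congr1 (fun M : 'M_n => complex.Re (M j k)) PP; rewrite !mxE -Re_sum => EE.
  have -> : (j == k)%:R = complex.Re (j == k)%:R :> R by case: (j == k).
  rewrite -EE; apply: eq_bigr => r _; rewrite !mxE !gE.
  by case: (P r j) (P r k) => [a b] [c d] /=; rewrite mulNr opprK.
have := congr1 (fun M : 'M_n => M j r) E2; rewrite mul_mx_diag !mxE => EE.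
have Drr : D ord0 r = (complex.Re (D ord0 r))%:C by rewrite RRe_real // (mxOverP Dr).
have ER := congr1 (@complex.Re R) EE; have EI := congr1 (@complex.Im R) EE.
rewrite -Re_sum in ER; rewrite -Im_sum in EI.
rewrite valK /=; split.
  transitivity (complex.Re ((P r j)^* * D ord0 r)).
    rewrite -ER; apply: eq_bigr => k _; rewrite !mxE gE.
    by case: (P r k) => [c d] /=; rewrite mul0r subr0.
  by rewrite gE Drr; case: (P r j) => [c d] /=; rewrite mulr0 subr0 mulrC.
(* The eigenvectors are the columns of [P^t*], so conjugation flips the sign of the imaginary parts;
   it is removed on both sides. *)
apply: oppr_inj; transitivity (complex.Im ((P r j)^* * D ord0 r)).
  rewrite -EI -sumrN; apply: eq_bigr => k _; rewrite !mxE gE.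
  by case: (P r k) => [c d] /=; rewrite mul0r addr0 mulrN.
by rewrite gE Drr; case: (P r j) => [c d] /=; rewrite mulr0 add0r mulNr mulrC.
Qed.

Lemma symmetric_frame n (M : nat -> nat -> R) :
  (forall j k, (j < n)%coq_nat -> (k < n)%coq_nat -> M j k = M k j) ->
  exists (a : nat -> R) (x y : nat -> nat -> R),
  (forall j k, (j < n)%coq_nat -> (k < n)%coq_nat ->
     sumR n (fun r => Rplus (Rmult (x r j) (x r k)) (Rmult (y r j) (y r k))) =
     if Nat.eqb j k then R1 else R0) /\
  (forall r j, (r < n)%coq_nat -> (j < n)%coq_nat ->
     sumR n (fun k => Rmult (M j k) (x r k)) = Rmult (a r) (x r j) /\
     sumR n (fun k => Rmult (M j k) (y r k)) = Rmult (a r) (y r j)).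
Proof.
move=> sym.
have [|a [x [y [F E]]]] := @symmetric_eigenframe n (\matrix_(i, j) M i j).
  by apply/matrixP => i j; rewrite !mxE; apply: sym; apply/ssrnat.ltP.
exists a, x, y; split=> [j k /ssrnat.ltP jn /ssrnat.ltP kn|r j /ssrnat.ltP rn /ssrnat.ltP jn].
  rewrite -big_sumR (F (Ordinal jn) (Ordinal kn)) -val_eqE /=.
  have -> : Nat.eqb j k = (j == k) by apply/Nat.eqb_spec/eqP.
  by case: (j == k).
have [E1 E2] := E (Ordinal rn) (Ordinal jn).
rewrite -!big_sumR; split; [rewrite -[RHS]E1|rewrite -[RHS]E2]; by apply: eq_bigr => k _; rewrite mxE.
Qed.
End Spectral.

(** * Finite sums and vectors *)

Definition lsum {T : Type} (l : list T) (f : T -> R) : R :=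
  fold_right Rplus 0 (map f l).

Lemma lsum_cons {T} (x : T) l f : lsum (x :: l) f = f x + lsum l f.
Proof. reflexivity. Qed.

Lemma lsum_nil {T} (f : T -> R) : lsum nil f = 0.
Proof. reflexivity. Qed.

Lemma lsum_ext {T} (l : list T) f g :
  (forall x, In x l -> f x = g x) -> lsum l f = lsum l g.
Proof.
  induction l as [|x l IH]; intros H; [reflexivity|].
  rewrite !lsum_cons, (H x), IH; [reflexivity| |left; reflexivity].
  intros y Hy; apply H; right; exact Hy.
Qed.

Lemma lsum_le {T} (l : list T) f g :
  (forall x, In x l -> f x <= g x) -> lsum l f <= lsum l g.
Proof.
  induction l as [|x l IH]; intros H; [apply Rle_refl|].
  rewrite !lsum_cons; apply Rplus_le_compat.
  - apply H; left; reflexivity.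
  - apply IH; intros y Hy; apply H; right; exact Hy.
Qed.

Lemma lsum_const0 {T} (l : list T) : lsum l (fun _ => 0) = 0.
Proof. induction l as [|x l IH]; [reflexivity|rewrite lsum_cons, IH; ring]. Qed.

Lemma lsum_eq0 {T} (l : list T) f : (forall x, In x l -> f x = 0) -> lsum l f = 0.
Proof. intros H; rewrite (lsum_ext l f (fun _ => 0) H); apply lsum_const0. Qed.

Lemma lsum_nonneg {T} (l : list T) f :
  (forall x, In x l -> 0 <= f x) -> 0 <= lsum l f.
Proof. intros H; rewrite <- (lsum_const0 l); apply lsum_le; exact H. Qed.

Lemma lsum_ge_term {T} (l : list T) f x :
  (forall y, In y l -> 0 <= f y) -> In x l -> f x <= lsum l f.
Proof.
  induction l as [|y l IH]; intros H Hx; [destruct Hx|].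
  rewrite lsum_cons.
  assert (0 <= f y) by (apply H; left; reflexivity).
  assert (0 <= lsum l f) by (apply lsum_nonneg; intros z Hz; apply H; right; exact Hz).
  destruct Hx as [<-|Hx]; [lra|].
  assert (f x <= lsum l f) by (apply IH; [intros z Hz; apply H; right; exact Hz|exact Hx]).
  lra.
Qed.

Lemma lsum_plus {T} (l : list T) f g :
  lsum l (fun x => f x + g x) = lsum l f + lsum l g.
Proof. induction l as [|x l IH]; [rewrite !lsum_nil; ring|rewrite !lsum_cons, IH; ring]. Qed.

Lemma lsum_minus {T} (l : list T) f g :
  lsum l (fun x => f x - g x) = lsum l f - lsum l g.
Proof. induction l as [|x l IH]; [rewrite !lsum_nil; ring|rewrite !lsum_cons, IH; ring]. Qed.

Lemma lsum_scal {T} (l : list T) c f : lsum l (fun x => c * f x) = c * lsum l f.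
Proof. induction l as [|x l IH]; [rewrite !lsum_nil; ring|rewrite !lsum_cons, IH; ring]. Qed.

Lemma lsum_scal_r {T} (l : list T) c f : lsum l (fun x => f x * c) = lsum l f * c.
Proof. induction l as [|x l IH]; [rewrite !lsum_nil; ring|rewrite !lsum_cons, IH; ring]. Qed.

Lemma lsum_app {T} (l l' : list T) f : lsum (l ++ l') f = lsum l f + lsum l' f.
Proof. induction l as [|x l IH]; [simpl app; rewrite !lsum_nil; ring|simpl app; rewrite !lsum_cons, IH; ring]. Qed.

Lemma lsum_map {T U} (h : T -> U) l f : lsum (map h l) f = lsum l (fun x => f (h x)).
Proof. unfold lsum; rewrite map_map; reflexivity. Qed.

Lemma lsum_flat_map {T U} (h : T -> list U) l f :
  lsum (flat_map h l) f = lsum l (fun x => lsum (h x) f).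
Proof.
  induction l as [|x l IH]; [reflexivity|].
  simpl flat_map; rewrite lsum_app, IH, lsum_cons; reflexivity.
Qed.

Lemma lsum_swap {T U} (l : list T) (l' : list U) f :
  lsum l (fun x => lsum l' (fun y => f x y)) = lsum l' (fun y => lsum l (fun x => f x y)).
Proof.
  induction l as [|x l IH]; [symmetry; apply lsum_const0|].
  rewrite lsum_cons, IH, <- lsum_plus; reflexivity.
Qed.

Lemma lsum_mult {T U} (l : list T) (l' : list U) f g :
  lsum l f * lsum l' g = lsum l (fun x => lsum l' (fun y => f x * g y)).
Proof.
  rewrite <- lsum_scal_r; apply lsum_ext; intros x _; rewrite lsum_scal; reflexivity.
Qed.

Definition idx (n : nat) : list nat := seq 0 n.

Lemma in_idx n i : In i (idx n) <-> (i < n)%nat.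
Proof. unfold idx; rewrite in_seq; lia. Qed.

Lemma sumR_lsum k f : sumR k f = lsum (idx k) f.
Proof. reflexivity. Qed.

Definition delta (j k : nat) : R := if Nat.eqb j k then 1 else 0.

Lemma lsum_delta n k f : (k < n)%nat -> lsum (idx n) (fun j => delta k j * f j) = f k.
Proof.
  unfold idx; intros H.
  replace n with (k + (1 + (n - k - 1)))%nat by lia.
  rewrite !seq_app, !lsum_app; cbn -[lsum delta].
  rewrite (lsum_eq0 (seq 0 k)), (lsum_eq0 (seq (k+1) _)).
  - cbn; unfold delta; rewrite Nat.eqb_refl; ring.
  - intros x Hx; apply in_seq in Hx; unfold delta.
    destruct (Nat.eqb_spec k x); [lia|ring].
  - intros x Hx; apply in_seq in Hx; unfold delta.
    destruct (Nat.eqb_spec k x); [lia|ring].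
Qed.

Lemma lsum_idx_1 n : lsum (idx n) (fun _ => 1) = INR n.
Proof.
  unfold idx; generalize 0%nat; induction n as [|n IH]; intros s; [reflexivity|].
  rewrite S_INR, <- (IH (S s)); simpl seq; rewrite lsum_cons; ring.
Qed.

Local Notation vec := (nat -> R).
Local Notation mat := (nat -> nat -> R).

Definition dot (n : nat) (u v : vec) : R := lsum (idx n) (fun j => u j * v j).
Definition mv (n : nat) (M : mat) (v : vec) : vec := fun j => lsum (idx n) (fun k => M j k * v k).
Definition bil (n : nat) (M : mat) (u v : vec) : R :=
  lsum (idx n) (fun j => lsum (idx n) (fun k => M j k * u j * v k)).
Definition mip (n : nat) (A S : mat) : R :=
  lsum (idx n) (fun j => lsum (idx n) (fun k => A j k * S j k)).
Definition trace (n : nat) (S : mat) : R := lsum (idx n) (fun j => S j j).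
Definition symm (n : nat) (M : mat) : Prop :=
  forall j k, (j < n)%nat -> (k < n)%nat -> M j k = M k j.
Definition psd (n : nat) (M : mat) : Prop := forall v, 0 <= qf n M v.

Lemma qf_bil n M v : qf n M v = bil n M v v.
Proof. reflexivity. Qed.

Lemma sqn_dot n v : sqn n v = dot n v v.
Proof. reflexivity. Qed.

Lemma dot_sym n u v : dot n u v = dot n v u.
Proof. apply lsum_ext; intros; ring. Qed.

Lemma dot_ext n u u' v v' :
  (forall j, (j < n)%nat -> u j = u' j) -> (forall j, (j < n)%nat -> v j = v' j) ->
  dot n u v = dot n u' v'.
Proof.
  intros Hu Hv; apply lsum_ext; intros j Hj; apply in_idx in Hj; rewrite Hu, Hv; auto.
Qed.

Lemma bil_dot n M u v : bil n M u v = dot n u (mv n M v).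
Proof.
  unfold bil, dot, mv; apply lsum_ext; intros j _.
  rewrite <- lsum_scal; apply lsum_ext; intros; ring.
Qed.

Lemma bil_sym n M u v : symm n M -> bil n M u v = bil n M v u.
Proof.
  intros H; unfold bil; rewrite lsum_swap.
  apply lsum_ext; intros j Hj; apply lsum_ext; intros k Hk.
  rewrite (H k j) by (apply in_idx; assumption); ring.
Qed.

Lemma sqn_nonneg n v : 0 <= sqn n v.
Proof. apply lsum_nonneg; intros; nra. Qed.

Lemma sqn_eq0 n v j : sqn n v = 0 -> (j < n)%nat -> v j = 0.
Proof.
  intros H Hj.
  assert (v j * v j <= sqn n v).
  { apply (lsum_ge_term (idx n) (fun i => v i * v i) j); [intros; nra|apply in_idx; exact Hj]. }
  nra.
Qed.

Lemma bil_lin_l n M u u' c v :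
  bil n M (fun j => u j + c * u' j) v = bil n M u v + c * bil n M u' v.
Proof.
  unfold bil; rewrite <- lsum_scal, <- lsum_plus; apply lsum_ext; intros j _.
  rewrite <- lsum_scal, <- lsum_plus; apply lsum_ext; intros k _; ring.
Qed.

Lemma bil_lin_r n M u v v' c :
  bil n M u (fun j => v j + c * v' j) = bil n M u v + c * bil n M u v'.
Proof.
  unfold bil; rewrite <- lsum_scal, <- lsum_plus; apply lsum_ext; intros j _.
  rewrite <- lsum_scal, <- lsum_plus; apply lsum_ext; intros k _; ring.
Qed.

Lemma qf_lin n M u v c : symm n M ->
  qf n M (fun j => u j + c * v j) = qf n M u + 2 * c * bil n M u v + c * c * qf n M v.
Proof.
  intros H; rewrite !qf_bil, bil_lin_l, !bil_lin_r, (bil_sym n M v u H); ring.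
Qed.

Lemma bil_delta n u v : bil n delta u v = dot n u v.
Proof.
  rewrite bil_dot; apply dot_ext; [auto|intros j Hj; unfold mv; apply lsum_delta; exact Hj].
Qed.

Lemma qf_delta n v : qf n delta v = sqn n v.
Proof. rewrite qf_bil, bil_delta; reflexivity. Qed.

Lemma symm_delta n : symm n delta.
Proof. intros j k _ _; unfold delta; rewrite Nat.eqb_sym; reflexivity. Qed.

Lemma sqn_lin n u v c :
  sqn n (fun j => u j + c * v j) = sqn n u + 2 * c * dot n u v + c * c * sqn n v.
Proof. rewrite <- !qf_delta, <- bil_delta; apply qf_lin, symm_delta. Qed.

Lemma cauchy_schwarz n u v : dot n u v * dot n u v <= sqn n u * sqn n v.
Proof.
  pose proof (sqn_nonneg n u) as Hu; pose proof (sqn_nonneg n v) as Hv.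
  destruct (Req_dec (sqn n v) 0) as [H0|H0].
  - assert (dot n u v = 0).
    { apply lsum_eq0; intros j Hj; apply in_idx in Hj; rewrite (sqn_eq0 n v j H0 Hj); ring. }
    nra.
  - pose proof (sqn_nonneg n (fun j => u j + (- dot n u v / sqn n v) * v j)) as H.
    rewrite sqn_lin in H.
    replace (sqn n u + 2 * (- dot n u v / sqn n v) * dot n u v +
             - dot n u v / sqn n v * (- dot n u v / sqn n v) * sqn n v)
      with (sqn n u - dot n u v * dot n u v / sqn n v) in H by (field; exact H0).
    apply (Rmult_le_compat_r (sqn n v)) in H; [|exact Hv].
    replace ((sqn n u - dot n u v * dot n u v / sqn n v) * sqn n v)
      with (sqn n u * sqn n v - dot n u v * dot n u v) in H by (field; exact H0).
    lra.
Qed.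

(* Expand [<A(u-Au), u-Au> >= 0] and use [A <= 1] on both squares. *)
Lemma contraction_mv n A u : symm n A ->
  (forall v, 0 <= qf n A v /\ qf n A v <= sqn n v) ->
  sqn n (mv n A u) <= sqn n u.
Proof.
  intros Hs HA.
  pose proof (proj1 (HA (fun j => u j + (-1) * mv n A u j))) as H.
  rewrite qf_lin in H by exact Hs.
  pose proof (proj2 (HA u)); pose proof (proj2 (HA (mv n A u))).
  rewrite (bil_sym n A u (mv n A u) Hs), bil_dot, <- sqn_dot in H; lra.
Qed.

(** A Parseval frame of eigenvectors: they need be neither orthogonal nor of length one, and some
    may be zero. Parseval's identity and the spectral decomposition survive, and the arguments on
    traces use nothing more. *)
Record eigenframe (n : nat) (M : mat) (fr : list (R * vec)) : Prop := {
  frame_tight : forall j k, (j < n)%nat -> (k < n)%nat ->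
    lsum fr (fun t => snd t j * snd t k) = delta j k;
  frame_nonneg : forall t, In t fr -> 0 <= fst t;
  frame_eigen : forall t, In t fr -> forall j, (j < n)%nat ->
    mv n M (snd t) j = fst t * snd t j }.

Lemma eigenframe_exists n M : symm n M -> psd n M -> exists fr, eigenframe n M fr.
Proof.
  intros Hs Hp.
  destruct (Spectral.symmetric_frame n M Hs) as (a & x & y & Ht & He).
  exists (flat_map (fun r => [(Rmax 0 (a r), x r); (Rmax 0 (a r), y r)]) (idx n)).
  (* Clipping at 0 alters only a negative eigenvalue, and since [M] is PSD its vector must then be
     zero and satisfies the equation for any eigenvalue. *)
  assert (key : forall c u, (forall j, (j < n)%nat -> mv n M u j = c * u j) ->
            forall j, (j < n)%nat -> mv n M u j = Rmax 0 c * u j).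
  { intros c u H j Hj; rewrite (H j Hj).
    destruct (Rle_dec 0 c) as [Hc|Hc]; [rewrite Rmax_right by exact Hc; reflexivity|].
    rewrite Rmax_left by lra.
    assert (Hq : qf n M u = c * sqn n u).
    { rewrite qf_bil, bil_dot, (dot_ext n u u _ (fun j => c * u j)); auto.
      unfold dot; rewrite sqn_dot; unfold dot; rewrite <- lsum_scal.
      apply lsum_ext; intros; ring. }
    pose proof (Hp u); pose proof (sqn_nonneg n u).
    rewrite (sqn_eq0 n u j); [ring| |exact Hj]; nra. }
  split.
  - intros j k Hj Hk; rewrite lsum_flat_map.
    change (delta j k) with (if Nat.eqb j k then R1 else R0); rewrite <- (Ht j k Hj Hk).
    apply lsum_ext; intros r _; cbn; ring.
  - intros t Hin; apply in_flat_map in Hin; destruct Hin as (r & _ & [<-|[<-|[]]]); apply Rmax_l.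
  - intros t Hin; apply in_flat_map in Hin; destruct Hin as (r & Hr & [<-|[<-|[]]]);
      apply in_idx in Hr; apply key; intros j Hj; apply (He r j Hr Hj).
Qed.

Lemma frame_parseval n M fr u v : eigenframe n M fr ->
  lsum fr (fun t => dot n u (snd t) * dot n v (snd t)) = dot n u v.
Proof.
  intros H.
  transitivity (lsum (idx n) (fun j => lsum (idx n) (fun k =>
                  lsum fr (fun t => u j * v k * (snd t j * snd t k))))).
  - rewrite (lsum_ext _ _ (fun t => lsum (idx n) (fun j => lsum (idx n) (fun k =>
                             u j * v k * (snd t j * snd t k))))).
    + rewrite lsum_swap; apply lsum_ext; intros j _; apply lsum_swap.
    + intros t _; unfold dot; rewrite lsum_mult.
      apply lsum_ext; intros j _; apply lsum_ext; intros k _; ring.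
  - rewrite <- bil_delta; unfold bil; apply lsum_ext; intros j Hj; apply lsum_ext; intros k Hk.
    apply in_idx in Hj; apply in_idx in Hk.
    rewrite lsum_scal, (frame_tight _ _ _ H j k Hj Hk); ring.
Qed.

(** Apply [M] to the resolution of the identity given by tightness; the eigenvector equations turn
    it into the spectral decomposition. *)
Lemma frame_entry n M fr j k : eigenframe n M fr -> (j < n)%nat -> (k < n)%nat ->
  M j k = lsum fr (fun t => fst t * (snd t j * snd t k)).
Proof.
  intros H Hj Hk.
  rewrite <- (lsum_delta n k (fun l => M j l) Hk).
  transitivity (lsum (idx n) (fun l => lsum fr (fun t => M j l * snd t l * snd t k))).
  - apply lsum_ext; intros l Hl; apply in_idx in Hl.
    rewrite <- (frame_tight _ _ _ H k l Hk Hl), <- lsum_scal_r.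
    apply lsum_ext; intros; ring.
  - rewrite lsum_swap; apply lsum_ext; intros t Ht.
    rewrite lsum_scal_r.
    pose proof (frame_eigen _ _ _ H t Ht j Hj) as E; unfold mv in E; rewrite E; ring.
Qed.

Lemma frame_mip n M fr A : eigenframe n M fr ->
  mip n A M = lsum fr (fun t => fst t * qf n A (snd t)).
Proof.
  intros H; unfold mip.
  rewrite (lsum_ext (idx n) _ (fun j => lsum (idx n) (fun k => lsum fr (fun t =>
             fst t * (A j k * snd t j * snd t k))))).
  - rewrite (lsum_ext (idx n) _ (fun j => lsum fr (fun t => lsum (idx n) (fun k =>
             fst t * (A j k * snd t j * snd t k))))) by (intros; apply lsum_swap).
    rewrite lsum_swap; apply lsum_ext; intros t _.
    unfold qf; rewrite !sumR_lsum, <- lsum_scal; apply lsum_ext; intros j _.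
    rewrite sumR_lsum, <- lsum_scal; reflexivity.
  - intros j Hj; apply lsum_ext; intros k Hk; apply in_idx in Hj; apply in_idx in Hk.
    rewrite (frame_entry n M fr j k H Hj Hk), <- lsum_scal; apply lsum_ext; intros; ring.
Qed.

Lemma mip_rank1 n M x : mip n (fun j k => x j * x k) M = qf n M x.
Proof. apply lsum_ext; intros j _; apply lsum_ext; intros k _; ring. Qed.

Lemma qf_rank1 n x v : qf n (fun j k => x j * x k) v = dot n x v * dot n x v.
Proof.
  unfold dot; rewrite lsum_mult.
  apply lsum_ext; intros j _; apply lsum_ext; intros k _; ring.
Qed.

Lemma frame_qf n M fr x : eigenframe n M fr ->
  lsum fr (fun t => fst t * (dot n x (snd t) * dot n x (snd t))) = qf n M x.
Proof.
  intros H; rewrite <- mip_rank1, (frame_mip n M fr _ H).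
  apply lsum_ext; intros t _; rewrite qf_rank1; reflexivity.
Qed.

Lemma mip_delta n M : mip n delta M = trace n M.
Proof. apply lsum_ext; intros j Hj; apply lsum_delta, in_idx, Hj. Qed.

Lemma frame_trace n M fr : eigenframe n M fr ->
  lsum fr (fun t => fst t * sqn n (snd t)) = trace n M.
Proof.
  intros H; rewrite <- mip_delta, (frame_mip n M fr _ H).
  apply lsum_ext; intros t _; rewrite qf_delta; reflexivity.
Qed.

Lemma frame_dim n M fr : eigenframe n M fr -> lsum fr (fun t => sqn n (snd t)) = INR n.
Proof.
  intros H; unfold sqn.
  rewrite (lsum_ext fr _ (fun t => lsum (idx n) (fun j => snd t j * snd t j)))
    by reflexivity.
  rewrite lsum_swap, (lsum_ext (idx n) _ (fun _ => 1)).
  - apply lsum_idx_1.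
  - intros j Hj; apply in_idx in Hj; rewrite (frame_tight _ _ _ H j j Hj Hj).
    unfold delta; rewrite Nat.eqb_refl; reflexivity.
Qed.

Lemma frame_qf_eigen n M fr t : eigenframe n M fr -> In t fr ->
  qf n M (snd t) = fst t * sqn n (snd t).
Proof.
  intros H Ht; rewrite qf_bil, bil_dot, sqn_dot.
  rewrite (dot_ext n (snd t) (snd t) _ (fun j => fst t * snd t j)); auto.
  - unfold dot; rewrite <- lsum_scal; apply lsum_ext; intros; ring.
  - apply (frame_eigen _ _ _ H t Ht).
Qed.

(** * A quantum Pinsker inequality along eigenframes *)

Lemma ln_le_sub1 x : 0 < x -> ln x <= x - 1.
Proof.
  intros H; pose proof (exp_ineq1_le (ln x)) as E; rewrite exp_ln in E by exact H; lra.
Qed.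

(* The Bregman divergence of x ln x dominates the Hellinger distance (sqrt a - sqrt b)^2,
   and (a - b)^2 = (sqrt a - sqrt b)^2 (sqrt a + sqrt b)^2. *)
Lemma bregman_ge a b : 0 < a -> 0 < b ->
  (a - b) * (a - b) <= 2 * (a + b) * (a * ln a - a * ln b - a + b).
Proof.
  intros Ha Hb.
  pose proof (sqrt_lt_R0 a Ha) as Hsa; pose proof (sqrt_lt_R0 b Hb) as Hsb.
  set (x := sqrt a) in *; set (y := sqrt b) in *.
  assert (Ea : a = x * x) by (symmetry; apply sqrt_sqrt; lra).
  assert (Eb : b = y * y) by (symmetry; apply sqrt_sqrt; lra).
  assert (L : 2 * (x * x) * (ln y - ln x) <= 2 * (x * y - x * x)).
  { pose proof (ln_le_sub1 (y * / x)) as E.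
    rewrite ln_mult, ln_Rinv in E by (try apply Rinv_0_lt_compat; lra).
    assert (0 < y * / x) by (apply Rmult_lt_0_compat; [lra|apply Rinv_0_lt_compat; lra]).
    specialize (E H).
    apply (Rmult_le_compat_l (2 * (x * x))) in E; [|nra].
    replace (2 * (x * x) * (y * / x - 1)) with (2 * (x * y - x * x)) in E by (field; lra).
    lra. }
  rewrite Ea, Eb, !ln_mult by lra.
  assert (G : (x - y) * (x - y) <=
    x * x * (ln x + ln x) - x * x * (ln y + ln y) - x * x + y * y) by lra.
  apply Rle_trans with (2 * (x * x + y * y) * ((x - y) * (x - y))).
  - replace ((x * x - y * y) * (x * x - y * y))
      with ((x + y) * (x + y) * ((x - y) * (x - y))) by ring.
    apply Rmult_le_compat_r; [apply Rle_0_sqr|pose proof (Rle_0_sqr (x - y)) as Q; unfold Rsqr in Q; lra].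
  - apply Rmult_le_compat_l; [nra|exact G].
Qed.

Lemma bregman_nonneg a b : 0 < a -> 0 < b -> 0 <= a * ln a - a * ln b - a + b.
Proof.
  intros Ha Hb; pose proof (bregman_ge a b Ha Hb).
  apply Rmult_le_reg_l with (2 * (a + b)); [lra|].
  rewrite Rmult_0_r; apply Rle_trans with ((a - b) * (a - b)); [apply Rle_0_sqr|exact H].
Qed.

(** Weighted AM-GM separates the factor [(a - b) * w] from [y], and [bregman_ge] absorbs the square
    of [a - b]. The parameter [th] stays free so that the bound is linear in the divergence and can
    be optimised after all steps are added. *)
Lemma bregman_product_bound a b w y th : 0 < a -> 0 < b -> 0 < th ->
  (a - b) * (w * y) <=
  2 / th * ((a * ln a - a * ln b - a + b) * (w * w)) + th / 4 * ((a + b) * (y * y)).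
Proof.
  intros Ha Hb Ht.
  pose proof (bregman_ge a b Ha Hb) as H.
  set (g := a * ln a - a * ln b - a + b) in *.
  set (s := a + b) in *; assert (Hs : 0 < s) by (unfold s; lra).
  assert (E : (a - b) * (w * y) <= / (th * s) * ((a - b) * (a - b) * (w * w)) + th / 4 * (s * (y * y))).
  { pose proof (Rle_0_sqr ((a - b) * w / (th * s) - y / 2)) as Q; unfold Rsqr in Q.
    apply (Rmult_le_compat_l (th * s)) in Q; [|nra].
    replace (th * s * (((a - b) * w / (th * s) - y / 2) * ((a - b) * w / (th * s) - y / 2)))
      with (/ (th * s) * ((a - b) * (a - b) * (w * w)) + th / 4 * (s * (y * y)) - (a - b) * (w * y))
      in Q by (field; lra).
    lra. }
  assert (F : / (th * s) * ((a - b) * (a - b) * (w * w)) <= 2 / th * (g * (w * w))).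
  { replace (2 / th * (g * (w * w))) with (/ (th * s) * (2 * s * g * (w * w))) by (field; lra).
    apply Rmult_le_compat_l; [apply Rlt_le, Rinv_0_lt_compat; nra|].
    apply Rmult_le_compat_r; [nra|exact H]. }
  lra.
Qed.

(* [p] times the negative entropy of [M / p + 1 / n], where [p] is the trace of [M];
   the shift by [1 / n] keeps the logarithms finite. *)
Definition potential (n : nat) (p : R) (fr : list (R * vec)) : R :=
  lsum fr (fun t => (fst t + p / INR n) * ln (fst t / p + / INR n) * sqn n (snd t)).

(** For a frame of [T] with trace [p] this is tr((S + q/n) ln(T/p + 1/n)), so [potential] minus it
    is [q] times a relative entropy. It is linear in the pair of [S] and [q], which makes the later
    sum over outcomes collapse. *)
Definition cross_potential (n : nat) (p : R) (fr : list (R * vec)) (q : R) (S : mat) : R :=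
  lsum fr (fun t => ln (fst t / p + / INR n) * (qf n S (snd t) + q / INR n * sqn n (snd t))).

Section OneStep.
Variables (n : nat) (A S T : mat) (fS fT : list (R * vec)) (th : R).
Hypothesis n_pos : (1 <= n)%nat.
Hypothesis A_sym : symm n A.
Hypothesis A_le1 : forall v, 0 <= qf n A v /\ qf n A v <= sqn n v.
Hypothesis frS : eigenframe n S fS.
Hypothesis frT : eigenframe n T fT.
Hypothesis th_pos : 0 < th.

Lemma dim_pos : 0 < INR n.
Proof. apply lt_0_INR; lia. Qed.

(** A coefficient depending on one frame only lets Parseval in the other frame remove the second
    sum. Both traces, potentials and error terms of [pinsker_step] are double sums of this kind. *)
Lemma lsum2_parseval_S (c : R * vec -> R) (X : vec -> vec) :
  lsum fS (fun t => lsum fT (fun s => c t * (dot n (snd t) (snd s) * dot n (X (snd t)) (snd s)))) =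
  lsum fS (fun t => c t * dot n (snd t) (X (snd t))).
Proof.
  apply lsum_ext; intros t _; rewrite lsum_scal, (frame_parseval n T fT); auto.
Qed.

Lemma lsum2_parseval_T (c : R * vec -> R) (X : vec -> vec) :
  lsum fS (fun t => lsum fT (fun s => c s * (dot n (snd s) (snd t) * dot n (X (snd s)) (snd t)))) =
  lsum fT (fun s => c s * dot n (snd s) (X (snd s))).
Proof.
  rewrite lsum_swap.
  apply lsum_ext; intros s _; rewrite lsum_scal, (frame_parseval n S fS); auto.
Qed.

Lemma dot_mv_swap u v : dot n u (mv n A v) = dot n (mv n A u) v.
Proof. rewrite <- bil_dot, (bil_sym n A u v A_sym), bil_dot, dot_sym; reflexivity. Qed.

(** The frame vectors have total squared norm [n], so the shift by [p / INR n] contributes a second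
    [p]. *)
Lemma shifted_trace M fr p : eigenframe n M fr -> trace n M = p ->
  lsum fr (fun t => (fst t + p / INR n) * sqn n (snd t)) = 2 * p.
Proof.
  intros H Hp.
  rewrite (lsum_ext fr _ (fun t => fst t * sqn n (snd t) + p / INR n * sqn n (snd t)))
    by (intros; ring).
  rewrite lsum_plus, lsum_scal, (frame_trace n M fr H), (frame_dim n M fr H), Hp.
  pose proof dim_pos; field; lra.
Qed.

Lemma shifted_trace_sq M fr p : eigenframe n M fr -> trace n M = p -> 0 <= p ->
  lsum fr (fun t => (fst t + p / INR n) * sqn n (mv n A (snd t))) <= 2 * p.
Proof.
  intros H Hp Hp0; rewrite <- (shifted_trace M fr p H Hp).
  apply lsum_le; intros t Ht; apply Rmult_le_compat_l; [|apply contraction_mv; auto].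
  pose proof (frame_nonneg _ _ _ H t Ht).
  assert (0 <= p / INR n) by (apply Rmult_le_pos; [lra|apply Rlt_le, Rinv_0_lt_compat, dim_pos]).
  lra.
Qed.

(* Pinsker's inequality for [S / q] against [T / p]: Bregman terms are compared
   pairwise along the two eigenframes, weighted by [<u, v>^2]. *)
Lemma pinsker_step p q : trace n T = p -> trace n S = q -> 0 < p -> 0 < q ->
  mip n A S - q / p * mip n A T <=
  th * q + 2 / th * (potential n q fS - cross_potential n p fT q S).
Proof.
  intros Hp Hq Pp Pq; pose proof dim_pos as Hn.
  assert (Hin : 0 < / INR n) by (apply Rinv_0_lt_compat; exact Hn).
  set (al := fun t : R * vec => fst t / q + / INR n).
  set (be := fun s : R * vec => fst s / p + / INR n).
  set (ca := fun t : R * vec => fst t + q / INR n).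
  set (cb := fun s : R * vec => q / p * (fst s + p / INR n)).
  set (w := fun t s : R * vec => dot n (snd t) (snd s)).
  set (y := fun t s : R * vec => dot n (mv n A (snd t)) (snd s)).
  set (D := fun F : (R * vec) -> (R * vec) -> R => lsum fS (fun t => lsum fT (fun s => F t s))).
  assert (Dplus : forall F G, D (fun t s => F t s + G t s) = D F + D G).
  { intros F G; unfold D; rewrite <- lsum_plus; apply lsum_ext; intros; apply lsum_plus. }
  assert (Dminus : forall F G, D (fun t s => F t s - G t s) = D F - D G).
  { intros F G; unfold D; rewrite <- lsum_minus; apply lsum_ext; intros; apply lsum_minus. }
  assert (Dscal : forall c F, D (fun t s => c * F t s) = c * D F).
  { intros c F; unfold D; rewrite <- lsum_scal; apply lsum_ext; intros; apply lsum_scal. }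
  (* With weights [w = <u, v>] and [y = <A u, v>] both traces become sums over pairs of
     eigenvectors, and the shift [/ INR n] cancels in [al t - be s]. The scalar bound, multiplied by
     [q], is applied to each pair. *)
  assert (Dle : D (fun t s => fst t * (w t s * y t s) - q / p * (fst s * (w t s * y t s))) <=
    D (fun t s => 2 / th * (ca t * ln (al t) * (w t s * w t s) - ca t * ln (be s) * (w t s * w t s)
                   - ca t * (w t s * w t s) + cb s * (w t s * w t s))
                   + th / 4 * (ca t * (y t s * y t s) + cb s * (y t s * y t s)))).
  { apply lsum_le; intros t Ht; apply lsum_le; intros s Hs.
    pose proof (frame_nonneg _ _ _ frS t Ht) as Nt; pose proof (frame_nonneg _ _ _ frT s Hs) as Ns.
    assert (Pa : 0 < al t).
    { unfold al; assert (0 <= fst t / q)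
        by (apply Rmult_le_pos; [lra|apply Rlt_le, Rinv_0_lt_compat; lra]); lra. }
    assert (Pb : 0 < be s).
    { unfold be; assert (0 <= fst s / p)
        by (apply Rmult_le_pos; [lra|apply Rlt_le, Rinv_0_lt_compat; lra]); lra. }
    assert (Ea : ca t = q * al t) by (unfold ca, al; field; lra).
    assert (Eb : cb s = q * be s) by (unfold cb, be; field; lra).
    assert (E : fst t * (w t s * y t s) - q / p * (fst s * (w t s * y t s)) =
                q * ((al t - be s) * (w t s * y t s))) by (unfold al, be; field; lra).
    rewrite E, Ea, Eb.
    pose proof (bregman_product_bound (al t) (be s) (w t s) (y t s) th Pa Pb th_pos) as H.
    apply (Rmult_le_compat_l q) in H; [|lra].
    eapply Rle_trans; [exact H|]; apply Req_le; ring. }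
  rewrite Dminus, Dscal, Dplus, !Dscal, !Dplus, !Dminus in Dle.
  assert (E1 : D (fun t s => fst t * (w t s * y t s)) = mip n A S).
  { unfold D, w, y; rewrite (lsum2_parseval_S (fun t => fst t) (mv n A)), (frame_mip n S fS A frS).
    apply lsum_ext; intros t _; rewrite <- bil_dot; reflexivity. }
  assert (E2 : D (fun t s => fst s * (w t s * y t s)) = mip n A T).
  { rewrite (frame_mip n T fT A frT).
    rewrite (lsum_ext fT _ (fun s => fst s * dot n (snd s) (mv n A (snd s))))
      by (intros s _; rewrite <- bil_dot; reflexivity).
    rewrite <- (lsum2_parseval_T (fun s => fst s) (mv n A)).
    apply lsum_ext; intros t _; apply lsum_ext; intros s _; unfold w, y.
    rewrite <- dot_mv_swap, (dot_sym n (snd t) (snd s)), (dot_sym n (snd t) (mv n A (snd s))).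
    reflexivity. }
  assert (E3 : D (fun t s => ca t * ln (al t) * (w t s * w t s)) = potential n q fS).
  { unfold D, w; rewrite (lsum2_parseval_S (fun t => ca t * ln (al t)) (fun v => v)).
    apply lsum_ext; intros t _; rewrite sqn_dot; reflexivity. }
  assert (E4 : D (fun t s => ca t * ln (be s) * (w t s * w t s)) = cross_potential n p fT q S).
  { unfold D; rewrite lsum_swap; apply lsum_ext; intros s _.
    fold (be s); rewrite <- (frame_qf n S fS (snd s) frS).
    rewrite sqn_dot, <- (frame_parseval n S fS (snd s) (snd s) frS), <- !lsum_scal, <- lsum_plus, <- lsum_scal.
    apply lsum_ext; intros t _; unfold w, ca; rewrite (dot_sym n (snd t) (snd s)); ring. }
  assert (E5 : D (fun t s => ca t * (w t s * w t s)) = 2 * q).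
  { unfold D, w; rewrite (lsum2_parseval_S ca (fun v => v)).
    rewrite <- (shifted_trace S fS q frS Hq); apply lsum_ext; intros; rewrite sqn_dot; reflexivity. }
  assert (E6 : D (fun t s => cb s * (w t s * w t s)) = 2 * q).
  { transitivity (lsum fT (fun s => cb s * dot n (snd s) (snd s))).
    - rewrite <- (lsum2_parseval_T cb (fun v => v)).
      apply lsum_ext; intros t _; apply lsum_ext; intros s _; unfold w.
      rewrite (dot_sym n (snd t) (snd s)); reflexivity.
    - transitivity (q / p * (2 * p)); [|field; lra].
      rewrite <- (shifted_trace T fT p frT Hp), <- lsum_scal.
      apply lsum_ext; intros; rewrite sqn_dot; unfold cb; ring. }
  assert (E7 : D (fun t s => ca t * (y t s * y t s)) <= 2 * q).
  { rewrite <- (Rmult_1_l (D _)).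
    eapply Rle_trans; [|apply (shifted_trace_sq S fS q frS Hq); lra].
    apply Req_le; rewrite Rmult_1_l; unfold D; apply lsum_ext; intros t _.
    unfold y; rewrite lsum_scal, (frame_parseval n T fT), sqn_dot by exact frT; reflexivity. }
  assert (E8 : D (fun t s => cb s * (y t s * y t s)) <= 2 * q).
  { apply Rle_trans with (q / p * (2 * p)); [|apply Req_le; field; lra].
    eapply Rle_trans; [|apply Rmult_le_compat_l;
      [apply Rmult_le_pos; [lra|apply Rlt_le, Rinv_0_lt_compat; lra]
      |apply (shifted_trace_sq T fT p frT Hp); lra]].
    apply Req_le; unfold D; rewrite lsum_swap, <- lsum_scal; apply lsum_ext; intros s _.
    rewrite sqn_dot, <- (frame_parseval n S fS (mv n A (snd s)) (mv n A (snd s)) frS), <- !lsum_scal.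
    apply lsum_ext; intros t _; unfold y, cb.
    rewrite <- dot_mv_swap, (dot_sym n (snd t)); ring. }
  rewrite E1, E2, E3, E4, E5, E6 in Dle.
  (* The linear terms of the divergence cancel by [E5] and [E6]. Since [A] is a contraction the
     quadratic error has mass at most [4 * q], whence the term [th * q]. *)
  assert (th / 4 * (D (fun t s => ca t * (y t s * y t s)) + D (fun t s => cb s * (y t s * y t s)))
          <= th / 4 * (4 * q)) by (apply Rmult_le_compat_l; lra).
  eapply Rle_trans; [exact Dle|].
  apply Rle_trans with (2 / th * (potential n q fS - cross_potential n p fT q S - 2 * q + 2 * q)
     + th / 4 * (4 * q)); [lra|apply Req_le; field; lra].
Qed.

End OneStep.

(** Jensen's inequality in tangent form: [x ln x] lies above its tangent at [c = 2 / n], the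
    eigenvalue of the maximally mixed state after the shift, which brings the trace to 2. *)
Lemma potential_lower n M fr p : (1 <= n)%nat -> eigenframe n M fr -> trace n M = p -> 0 < p ->
  2 * p * ln (2 / INR n) <= potential n p fr.
Proof.
  intros Hn H Hp Pp; pose proof (dim_pos n Hn) as Pn.
  assert (Hin : 0 < / INR n) by (apply Rinv_0_lt_compat; exact Pn).
  set (c := 2 / INR n); assert (Pc : 0 < c) by (unfold c, Rdiv; lra).
  apply Rle_trans with (lsum fr (fun t =>
     (1 + ln c) * ((fst t + p / INR n) * sqn n (snd t)) - p * c * sqn n (snd t))).
  - rewrite lsum_minus, !lsum_scal, (shifted_trace n Hn M fr p H Hp), (frame_dim n M fr H).
    unfold c; apply Req_le; field; lra.
  - apply lsum_le; intros t Ht.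
    pose proof (frame_nonneg _ _ _ H t Ht) as Nt.
    set (al := fst t / p + / INR n).
    assert (Pa : 0 < al).
    { unfold al; assert (0 <= fst t / p)
        by (apply Rmult_le_pos; [lra|apply Rlt_le, Rinv_0_lt_compat; lra]); lra. }
    replace (fst t + p / INR n) with (p * al) by (unfold al; field; lra).
    pose proof (bregman_nonneg al c Pa Pc) as G; pose proof (sqn_nonneg n (snd t)) as Q.
    assert (0 <= p * sqn n (snd t) * (al * ln al - al * ln c - al + c))
      by (apply Rmult_le_pos; [apply Rmult_le_pos; lra|exact G]).
    lra.
Qed.

Lemma qf_le_trace n M fr v : eigenframe n M fr -> qf n M v <= trace n M * sqn n v.
Proof.
  intros H; rewrite <- (frame_qf n M fr v H), <- (frame_trace n M fr H), <- lsum_scal_r.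
  apply lsum_le; intros t Ht; rewrite Rmult_assoc.
  apply Rmult_le_compat_l; [apply (frame_nonneg _ _ _ H t Ht)|].
  rewrite (Rmult_comm (sqn n (snd t))); apply cauchy_schwarz.
Qed.

(** Eigenvalues of a density matrix are at most 1, so every logarithm is at most [ln (1 + / INR n)],
    against a total weight of [2 * p]. *)
Lemma potential_upper n M fr p : (1 <= n)%nat -> eigenframe n M fr -> trace n M = p -> 0 < p ->
  potential n p fr <= 2 * p * ln (1 + / INR n).
Proof.
  intros Hn H Hp Pp; pose proof (dim_pos n Hn) as Pn.
  assert (Hin : 0 < / INR n) by (apply Rinv_0_lt_compat; exact Pn).
  rewrite <- (shifted_trace n Hn M fr p H Hp), <- lsum_scal_r.
  apply lsum_le; intros t Ht.
  pose proof (frame_nonneg _ _ _ H t Ht) as Nt; pose proof (sqn_nonneg n (snd t)) as Q.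
  assert (N1 : 0 <= fst t / p)
    by (apply Rmult_le_pos; [lra|apply Rlt_le, Rinv_0_lt_compat; lra]).
  assert (N2 : 0 < p / INR n) by (apply Rmult_lt_0_compat; lra).
  (* The eigenvalue attached to a zero vector is arbitrary and need not be at most [p], but its term
     vanishes. *)
  destruct (Req_dec (sqn n (snd t)) 0) as [E|E]; [rewrite E; lra|].
  pose proof (qf_le_trace n M fr (snd t) H) as L.
  rewrite (frame_qf_eigen n M fr t H Ht), Hp in L.
  assert (Le : fst t <= p) by (apply Rmult_le_reg_r with (sqn n (snd t)); lra).
  assert (L1 : fst t / p <= 1).
  { apply Rmult_le_reg_r with p; [lra|]; replace (fst t / p * p) with (fst t) by (field; lra); lra. }
  rewrite (Rmult_comm (_ * ln _)), <- Rmult_assoc, (Rmult_comm (sqn n (snd t))).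
  apply Rmult_le_compat_l; [apply Rmult_le_pos; lra|].
  destruct (Req_dec (fst t / p) 1) as [->|Ne]; [lra|].
  apply Rlt_le, ln_increasing; lra.
Qed.

(** For an outcome of probability zero the argument of the logarithm is a meaningless quotient by 0;
    each coefficient is zero, because a sum of nonnegative terms equal to the trace vanishes. *)
Lemma potential_trace0 n M fr : eigenframe n M fr -> trace n M = 0 -> potential n 0 fr = 0.
Proof.
  intros H H0; apply lsum_eq0; intros t Ht.
  assert (E : fst t * sqn n (snd t) = 0).
  { apply Rle_antisym.
    - rewrite <- H0, <- (frame_trace n M fr H).
      apply (lsum_ge_term fr (fun t => fst t * sqn n (snd t))); [|exact Ht].
      intros s Hs; apply Rmult_le_pos; [apply (frame_nonneg _ _ _ H s Hs)|apply sqn_nonneg].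
    - apply Rmult_le_pos; [apply (frame_nonneg _ _ _ H t Ht)|apply sqn_nonneg]. }
  replace (fst t + 0 / INR n) with (fst t) by (unfold Rdiv; ring).
  rewrite (Rmult_comm (fst t)), Rmult_assoc, E; ring.
Qed.

Lemma mip_le_trace n A M fr : eigenframe n M fr -> (forall v, qf n A v <= sqn n v) ->
  mip n A M <= trace n M.
Proof.
  intros H HA; rewrite (frame_mip n M fr A H), <- (frame_trace n M fr H).
  apply lsum_le; intros t Ht; apply Rmult_le_compat_l; [apply (frame_nonneg _ _ _ H t Ht)|apply HA].
Qed.

Lemma psd_trace_nonneg n M fr : eigenframe n M fr -> 0 <= trace n M.
Proof.
  intros H; rewrite <- (frame_trace n M fr H); apply lsum_nonneg; intros t Ht.
  apply Rmult_le_pos; [apply (frame_nonneg _ _ _ H t Ht)|apply sqn_nonneg].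
Qed.

(** Covers outcomes of probability zero: trace 0 forces the form of the PSD matrix [S] to vanish, so
    both potentials are 0. *)
Lemma pinsker_step_ge0 n A S T fS fT th p q :
  (1 <= n)%nat -> symm n A -> (forall v, 0 <= qf n A v /\ qf n A v <= sqn n v) ->
  eigenframe n S fS -> eigenframe n T fT -> 0 < th ->
  trace n T = p -> trace n S = q -> 0 < p -> psd n S ->
  mip n A S - q / p * mip n A T <=
  th * q + 2 / th * (potential n q fS - cross_potential n p fT q S).
Proof.
  intros Hn As HA HS HT Hth Hp Hq Pp PS.
  pose proof (psd_trace_nonneg n S fS HS) as Q; rewrite Hq in Q.
  destruct (Rle_lt_or_eq_dec 0 q Q) as [Pq|Zq]; [apply pinsker_step; assumption|].
  subst q; rewrite <- Zq.
  rewrite (potential_trace0 n S fS HS (eq_sym Zq)).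
  replace (cross_potential n p fT 0 S) with 0.
  - pose proof (mip_le_trace n A S fS HS (fun v => proj2 (HA v))) as L; rewrite <- Zq in L.
    unfold Rdiv; rewrite !Rmult_0_l; lra.
  - symmetry; apply lsum_eq0; intros t _.
    pose proof (qf_le_trace n S fS (snd t) HS) as L; rewrite <- Zq, Rmult_0_l in L.
    replace (qf n S (snd t)) with 0 by (apply Rle_antisym; [apply PS|exact L]).
    unfold Rdiv; ring.
Qed.

(** * Rounding second moments to points of the sphere *)

Lemma qf_scale n A c v : qf n A (fun j => c * v j) = c * c * qf n A v.
Proof.
  unfold qf; rewrite !sumR_lsum, <- lsum_scal; apply lsum_ext; intros j _.
  rewrite !sumR_lsum, <- lsum_scal; apply lsum_ext; intros k _; ring.
Qed.

(** The factorisation [M = sum v v^T], with [v] an eigenvector scaled by the root of its eigenvalue.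
    It is stated by pairing with an arbitrary [A], the form in which it expands traces and writes a
    PSD form as a sum of squares. *)
Lemma psd_vectors n M : symm n M -> psd n M ->
  exists vs : list vec, forall A, mip n A M = lsum vs (fun v => qf n A v).
Proof.
  intros Hs Hp; destruct (eigenframe_exists n M Hs Hp) as [fr H].
  exists (map (fun t j => sqrt (fst t) * snd t j) fr); intros A.
  rewrite lsum_map, (frame_mip n M fr A H); apply lsum_ext; intros t Ht.
  rewrite qf_scale, sqrt_sqrt; [reflexivity|apply (frame_nonneg _ _ _ H t Ht)].
Qed.

Lemma psd_vectors_bil n M (vs : list vec) x y :
  (forall A, mip n A M = lsum vs (fun v => qf n A v)) ->
  bil n M x y = lsum vs (fun v => dot n x v * dot n y v).
Proof.
  intros H; transitivity (mip n (fun j k => x j * y k) M).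
  - apply lsum_ext; intros j _; apply lsum_ext; intros k _; ring.
  - rewrite H; apply lsum_ext; intros v _; unfold dot; rewrite lsum_mult.
    apply lsum_ext; intros j _; apply lsum_ext; intros k _; ring.
Qed.

Lemma qf_lsum n B (vs : list vec) (c : vec -> R) :
  qf n B (fun j => lsum vs (fun v => c v * v j)) =
  lsum vs (fun v => lsum vs (fun w => c v * c w * bil n B v w)).
Proof.
  assert (L : forall (l : list vec) u, bil n B (fun j => lsum l (fun v => c v * v j)) u =
                  lsum l (fun v => c v * bil n B v u)).
  { intros l u; induction l as [|v l IH].
    - apply lsum_eq0; intros j _; apply lsum_eq0; intros k _; rewrite lsum_nil; ring.
    - rewrite lsum_cons, <- IH, <- (Rmult_1_l (bil n B (fun j => lsum l _) u)), Rplus_comm.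
      rewrite Rmult_1_l, <- bil_lin_l.
      apply lsum_ext; intros j _; apply lsum_ext; intros k _; rewrite lsum_cons; ring. }
  assert (R : forall (l : list vec) u, bil n B u (fun j => lsum l (fun v => c v * v j)) =
                  lsum l (fun v => c v * bil n B u v)).
  { intros l u; induction l as [|v l IH].
    - apply lsum_eq0; intros j _; apply lsum_eq0; intros k _; rewrite lsum_nil; ring.
    - rewrite lsum_cons, <- IH, Rplus_comm, <- bil_lin_r.
      apply lsum_ext; intros j _; apply lsum_ext; intros k _; rewrite lsum_cons; ring. }
  rewrite qf_bil, L; apply lsum_ext; intros v _.
  rewrite R, <- lsum_scal; apply lsum_ext; intros; ring.
Qed.

(** An instance of the Schur product theorem for the two Gram matrices. Writing [A] as a sum of
    squares along [us] turns the double sum into values of [B] at the vectors [sum <v, u> v]. *)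
Lemma lsum_bil_mult_nonneg n A B (vs : list vec) : symm n A -> psd n A -> psd n B ->
  0 <= lsum vs (fun v => lsum vs (fun w => bil n A v w * bil n B v w)).
Proof.
  intros Hs HA HB; destruct (psd_vectors n A Hs HA) as [us Hu].
  replace (lsum vs _) with
    (lsum us (fun u => qf n B (fun j => lsum vs (fun v => dot n v u * v j)))).
  - apply lsum_nonneg; intros; apply HB.
  - rewrite (lsum_ext us _ (fun u => lsum vs (fun v => lsum vs (fun w =>
        dot n v u * dot n w u * bil n B v w)))) by (intros; apply qf_lsum).
    rewrite lsum_swap; apply lsum_ext; intros v _.
    rewrite lsum_swap; apply lsum_ext; intros w _.
    rewrite (psd_vectors_bil n A us v w Hu), lsum_scal_r; reflexivity.
Qed.

(** The expectation of [G] at [x] plus an independently signed sum of [vs]. The starting point [x]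
    is there for the induction on [vs]. *)
Fixpoint sign_avg (vs : list vec) (x : vec) (G : vec -> R) : R :=
  match vs with
  | nil => G x
  | v :: vs' => (sign_avg vs' (fun j => x j + 1 * v j) G +
                 sign_avg vs' (fun j => x j + (-1) * v j) G) / 2
  end.

Lemma sign_avg_le vs G G' : (forall x, G x <= G' x) ->
  forall x, sign_avg vs x G <= sign_avg vs x G'.
Proof.
  intros H; induction vs as [|v vs IH]; intros x; simpl; [apply H|].
  pose proof (IH (fun j => x j + 1 * v j)); pose proof (IH (fun j => x j + (-1) * v j)); lra.
Qed.

Lemma sign_avg_lsum {T} (l : list T) (G : T -> vec -> R) vs : forall x,
  sign_avg vs x (fun y => lsum l (fun i => G i y)) = lsum l (fun i => sign_avg vs x (G i)).
Proof.
  induction vs as [|v vs IH]; intros x; simpl; [reflexivity|].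
  rewrite !IH, <- lsum_plus; unfold Rdiv; rewrite <- lsum_scal_r; reflexivity.
Qed.

Lemma sign_avg_scal c G vs : forall x,
  sign_avg vs x (fun y => c * G y) = c * sign_avg vs x G.
Proof.
  induction vs as [|v vs IH]; intros x; simpl; [reflexivity|].
  rewrite !IH; unfold Rdiv; ring.
Qed.

Section FourthMoment.
Variables (n : nat) (A B : mat).
Hypothesis A_sym : symm n A.
Hypothesis B_sym : symm n B.

(** Only products in which every sign occurs evenly survive. The three pairings of four factors give
    the product of the sums and twice the mixed sum; a vector used four times is counted three
    times, hence the final correction. *)
Lemma sign_avg_qf_mult (vs : list vec) : forall x,
  sign_avg vs x (fun y => qf n A y * qf n B y) =
  qf n A x * qf n B x + qf n A x * lsum vs (fun v => qf n B v)
  + qf n B x * lsum vs (fun v => qf n A v)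
  + 4 * lsum vs (fun v => bil n A x v * bil n B x v)
  + lsum vs (fun v => qf n A v) * lsum vs (fun v => qf n B v)
  + 2 * lsum vs (fun v => lsum vs (fun w => bil n A v w * bil n B v w))
  - 2 * lsum vs (fun v => qf n A v * qf n B v).
Proof.
  induction vs as [|v vs IH]; intros x; simpl sign_avg.
  - rewrite !lsum_nil; ring.
  - rewrite !IH, !qf_lin, !lsum_cons by assumption.
    rewrite (lsum_ext vs (fun v0 => lsum (v :: vs) _)
      (fun u => bil n A v u * bil n B v u + lsum vs (fun w => bil n A u w * bil n B u w))).
    2:{ intros u _; rewrite lsum_cons, (bil_sym n A u v), (bil_sym n B u v) by assumption.
        reflexivity. }
    rewrite lsum_plus, <- (qf_bil n A v), <- (qf_bil n B v).
    assert (E : forall c, lsum vs (fun u => bil n A (fun j => x j + c * v j) u *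
                             bil n B (fun j => x j + c * v j) u) =
       lsum vs (fun u => bil n A x u * bil n B x u)
       + c * lsum vs (fun u => bil n A x u * bil n B v u + bil n A v u * bil n B x u)
       + c * c * lsum vs (fun u => bil n A v u * bil n B v u)).
    { intros c; rewrite <- !lsum_scal, <- !lsum_plus; apply lsum_ext; intros u _.
      rewrite !bil_lin_l; ring. }
    rewrite !E; field.
Qed.

Lemma sign_avg_qf_mult0 (vs : list vec) :
  sign_avg vs (fun _ => 0) (fun y => qf n A y * qf n B y) =
  lsum vs (fun v => qf n A v) * lsum vs (fun v => qf n B v)
  + 2 * lsum vs (fun v => lsum vs (fun w => bil n A v w * bil n B v w))
  - 2 * lsum vs (fun v => qf n A v * qf n B v).
Proof.
  assert (Z : forall C u, bil n C (fun _ => 0) u = 0).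
  { intros C u; apply lsum_eq0; intros j _; apply lsum_eq0; intros k _; ring. }
  rewrite sign_avg_qf_mult, !qf_bil, !Z.
  rewrite (lsum_eq0 vs (fun v => bil n A (fun _ => 0) v * bil n B (fun _ => 0) v)).
  - ring.
  - intros v _; rewrite !Z; ring.
Qed.
End FourthMoment.

(* Evaluate P at a random signed sum of vectors v with M = sum v v^T. *)
Lemma rounding_single n m (A B : nat -> mat) N M : 0 <= N ->
  (forall i, (i < m)%nat -> symm n (A i) /\ psd n (A i) /\ symm n (B i) /\ psd n (B i)) ->
  (forall x, lsum (idx m) (fun i => qf n (A i) x * qf n (B i) x) <= N * (sqn n x * sqn n x)) ->
  symm n M -> psd n M ->
  lsum (idx m) (fun i => mip n (A i) M * mip n (B i) M) <= 3 * N * (trace n M * trace n M).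
Proof.
  intros HN HAB HP Ms Mp; destruct (psd_vectors n M Ms Mp) as [vs Hv].
  pose proof (sign_avg_le vs _ _ HP (fun _ => 0)) as H.
  rewrite sign_avg_lsum, sign_avg_scal in H.
  replace (fun y => sqn n y * sqn n y) with (fun y => qf n delta y * qf n delta y) in H
    by (apply functional_extensionality; intros y; rewrite qf_delta; reflexivity).
  rewrite (sign_avg_qf_mult0 n delta delta) in H by apply symm_delta.
  rewrite <- !(Hv delta), mip_delta in H.
  rewrite (lsum_ext (idx m) _ (fun i => mip n (A i) M * mip n (B i) M
     + (2 * lsum vs (fun v => lsum vs (fun w => bil n (A i) v w * bil n (B i) v w))
        - 2 * lsum vs (fun v => qf n (A i) v * qf n (B i) v)))) in H.
  2:{ intros i Hi; apply in_idx in Hi; destruct (HAB i Hi) as (a & b & c & d).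
      rewrite (sign_avg_qf_mult0 n (A i) (B i) a c), !Hv; ring. }
  rewrite lsum_plus, lsum_minus, !lsum_scal in H.
  assert (Q0 : 0 <= lsum (idx m) (fun i => lsum vs (fun v => lsum vs (fun w =>
                      bil n (A i) v w * bil n (B i) v w)))).
  { apply lsum_nonneg; intros i Hi; apply in_idx in Hi; destruct (HAB i Hi) as (a & b & c & d).
    apply lsum_bil_mult_nonneg; assumption. }
  (* The diagonal corrections on the two sides cancel: the bound on [P] at each single [v] makes the
     left one at most [N] times the right one. The mixed sum [Q0] on the left is dropped, and [Q1]
     turns the right side into 1 + 2 copies of the squared trace. *)
  assert (D0 : lsum (idx m) (fun i => lsum vs (fun v => qf n (A i) v * qf n (B i) v)) <=
               N * lsum vs (fun v => qf n delta v * qf n delta v)).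
  { rewrite lsum_swap, <- lsum_scal; apply lsum_le; intros v _; rewrite !qf_delta; apply HP. }
  assert (Q1 : lsum vs (fun v => lsum vs (fun w => bil n delta v w * bil n delta v w)) <=
               trace n M * trace n M).
  { rewrite <- mip_delta, Hv, lsum_mult.
    apply lsum_le; intros v _; apply lsum_le; intros w _.
    rewrite !bil_delta, !qf_delta; apply cauchy_schwarz. }
  apply (Rmult_le_compat_l N) in Q1; [|exact HN]; lra.
Qed.

(** This and [delta_hi] are the forms [||Y||^2] and [||Z||^2] of part (2). *)
Definition delta_lo (p : nat) : mat := fun j k => if (j <? p)%nat then delta j k else 0.
Definition delta_hi (p : nat) : mat := fun j k => if (j <? p)%nat then 0 else delta j k.

Lemma lsum_delta_l n j f : (j < n)%nat -> lsum (idx n) (fun k => delta j k * f k) = f j.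
Proof.
  intros H; rewrite <- (lsum_delta n j f H); apply lsum_ext; intros k _.
  unfold delta; rewrite Nat.eqb_sym; reflexivity.
Qed.

Lemma qf_delta_lo n p v :
  qf n (delta_lo p) v = lsum (idx n) (fun j => if (j <? p)%nat then v j * v j else 0).
Proof.
  apply lsum_ext; intros j Hj; apply in_idx in Hj; rewrite sumR_lsum; unfold delta_lo.
  destruct (j <? p)%nat.
  - rewrite <- (lsum_delta_l n j (fun k => v j * v k) Hj); apply lsum_ext; intros; ring.
  - apply lsum_eq0; intros; ring.
Qed.

Lemma qf_delta_hi n p v :
  qf n (delta_hi p) v = lsum (idx n) (fun j => if (j <? p)%nat then 0 else v j * v j).
Proof.
  apply lsum_ext; intros j Hj; apply in_idx in Hj; rewrite sumR_lsum; unfold delta_hi.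
  destruct (j <? p)%nat.
  - apply lsum_eq0; intros; ring.
  - rewrite <- (lsum_delta_l n j (fun k => v j * v k) Hj); apply lsum_ext; intros; ring.
Qed.

Definition splice (p : nat) (v w : vec) : vec := fun j => if (j <? p)%nat then v j else w j.

Lemma sqn_splice n p v w : sqn n (splice p v w) = qf n (delta_lo p) v + qf n (delta_hi p) w.
Proof.
  rewrite qf_delta_lo, qf_delta_hi, <- lsum_plus; apply lsum_ext; intros j _; unfold splice.
  destruct (j <? p)%nat; ring.
Qed.

Lemma qf_splice_lo n p A v w :
  (forall j k, (p <= j \/ p <= k)%nat -> A j k = 0) -> qf n A (splice p v w) = qf n A v.
Proof.
  intros H; apply lsum_ext; intros j _; apply lsum_ext; intros k _; unfold splice.
  destruct (Nat.ltb_spec j p), (Nat.ltb_spec k p); try reflexivity; rewrite H by lia; ring.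
Qed.

Lemma qf_splice_hi n p B v w :
  (forall j k, (j < p \/ k < p)%nat -> B j k = 0) -> qf n B (splice p v w) = qf n B w.
Proof.
  intros H; apply lsum_ext; intros j _; apply lsum_ext; intros k _; unfold splice.
  destruct (Nat.ltb_spec j p), (Nat.ltb_spec k p); try reflexivity; rewrite H by lia; ring.
Qed.

Lemma qf_0 n M : qf n M (fun _ => 0) = 0.
Proof. apply lsum_eq0; intros j _; apply lsum_eq0; intros k _; ring. Qed.

Lemma psd_delta_lo n p : psd n (delta_lo p).
Proof.
  intros v; rewrite qf_delta_lo; apply lsum_nonneg; intros.
  destruct (_ <? _)%nat; [apply Rle_0_sqr|lra].
Qed.

Lemma psd_delta_hi n p : psd n (delta_hi p).
Proof.
  intros v; rewrite qf_delta_hi; apply lsum_nonneg; intros.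
  destruct (_ <? _)%nat; [lra|apply Rle_0_sqr].
Qed.

Section BipartiteRounding.
Variables (n m p : nat) (A B : nat -> mat) (N : R).
Hypothesis A_le1 : forall i v, (i < m)%nat -> 0 <= qf n (A i) v /\ qf n (A i) v <= sqn n v.
Hypothesis B_psd : forall i v, (i < m)%nat -> 0 <= qf n (B i) v.
Hypothesis B_sum : forall v, lsum (idx m) (fun i => qf n (B i) v) <= sqn n v.
Hypothesis A_lo : forall i j k, (i < m)%nat -> (p <= j \/ p <= k)%nat -> A i j k = 0.
Hypothesis B_hi : forall i j k, (i < m)%nat -> (j < p \/ k < p)%nat -> B i j k = 0.
Hypothesis P_le : forall x,
  lsum (idx m) (fun i => qf n (A i) x * qf n (B i) x) <= N * (sqn n x * sqn n x).

(* Rescale v and w to unit length, so that the spliced vector has squared norm 2. *)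
Lemma bipartite_pair v w :
  lsum (idx m) (fun i => qf n (A i) v * qf n (B i) w) <=
  4 * N * (qf n (delta_lo p) v * qf n (delta_hi p) w).
Proof.
  pose proof (psd_delta_lo n p v) as Pv; pose proof (psd_delta_hi n p w) as Pw.
  (* If the block [v_Y] is zero it cannot be rescaled, but [A_i <= ||X||^2] at [(v_Y, 0)] forces
     [A_i] to vanish there. The next case treats [w_Z] in the same way through the bound on the sum
     of the [B_i]. *)
  destruct (Req_dec (qf n (delta_lo p) v) 0) as [E|E].
  { rewrite E, lsum_eq0; [lra|]; intros i Hi; apply in_idx in Hi.
    assert (qf n (A i) v = 0); [|rewrite H; ring].
    destruct (A_le1 i (splice p v (fun _ => 0)) Hi) as [H1 H2].
    rewrite sqn_splice, qf_0, E, (qf_splice_lo n p (A i)) in H2 by (intros; apply A_lo; assumption).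
    rewrite (qf_splice_lo n p (A i)) in H1 by (intros; apply A_lo; assumption); lra. }
  destruct (Req_dec (qf n (delta_hi p) w) 0) as [F|F].
  { rewrite F, lsum_eq0; [lra|]; intros i Hi.
    assert (qf n (B i) w = 0); [|rewrite H; ring].
    pose proof (B_sum (splice p (fun _ => 0) w)) as S; rewrite sqn_splice, qf_0, F in S.
    rewrite (lsum_ext (idx m) _ (fun i => qf n (B i) w)) in S.
    2:{ intros k Hk; apply in_idx in Hk; apply qf_splice_hi; intros; apply B_hi; assumption. }
    pose proof (lsum_ge_term (idx m) (fun i => qf n (B i) w) i
                 (fun k Hk => B_psd k w (proj1 (in_idx m k) Hk)) Hi) as G; cbn beta in G.
    apply in_idx in Hi; pose proof (B_psd i w Hi); lra. }
  set (a := qf n (delta_lo p) v) in *; set (b := qf n (delta_hi p) w) in *.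
  assert (Pa : 0 < a) by lra; assert (Pb : 0 < b) by lra.
  assert (Sa : sqrt (/ a) * sqrt (/ a) = / a)
    by (apply sqrt_sqrt, Rlt_le, Rinv_0_lt_compat, Pa).
  assert (Sb : sqrt (/ b) * sqrt (/ b) = / b)
    by (apply sqrt_sqrt, Rlt_le, Rinv_0_lt_compat, Pb).
  pose proof (P_le (splice p (fun j => sqrt (/ a) * v j) (fun j => sqrt (/ b) * w j))) as H.
  rewrite sqn_splice, !qf_scale, Sa, Sb in H; fold a b in H.
  rewrite (lsum_ext (idx m) _ (fun i => / a * / b * (qf n (A i) v * qf n (B i) w))) in H.
  2:{ intros i Hi; apply in_idx in Hi.
      rewrite (qf_splice_lo n p (A i)) by (intros; apply A_lo; assumption).
      rewrite (qf_splice_hi n p (B i)) by (intros; apply B_hi; assumption).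
      rewrite !qf_scale, Sa, Sb; ring. }
  rewrite lsum_scal in H.
  apply (Rmult_le_compat_l (a * b)) in H; [|nra].
  set (s := lsum _ _) in *.
  replace (a * b * (/ a * / b * s)) with s in H by (field; lra).
  replace (a * b * (N * ((/ a * a + / b * b) * (/ a * a + / b * b)))) with (4 * N * (a * b)) in H
    by (field; lra).
  exact H.
Qed.

(** The two traces expand over independent vectors, and every pair [(v, w)] gives a point at which
    [P] may be evaluated, so no random signs and no factor 3 arise. The factor 4 is compensated when
    each block carries half of the trace. *)
Lemma rounding_bipartite M : symm n M -> psd n M ->
  lsum (idx m) (fun i => mip n (A i) M * mip n (B i) M) <=
  4 * N * (mip n (delta_lo p) M * mip n (delta_hi p) M).
Proof.
  intros Ms Mp; destruct (psd_vectors n M Ms Mp) as [vs Hv].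
  rewrite !Hv, lsum_mult, <- lsum_scal.
  rewrite (lsum_ext (idx m) _ (fun i => lsum vs (fun v => lsum vs (fun w =>
             qf n (A i) v * qf n (B i) w)))) by (intros; rewrite !Hv, lsum_mult; reflexivity).
  rewrite lsum_swap; apply lsum_le; intros v _.
  rewrite lsum_swap, <- lsum_scal; apply lsum_le; intros w _; apply bipartite_pair.
Qed.
End BipartiteRounding.

(** * Conditioning a pseudoexpectation on measurement outcomes *)

Definition mvar (i : nat) : mono := fun j => if Nat.eqb j i then 1%nat else 0%nat.
Definition mvar2 (j k : nat) : mono := mmul (mvar j) (mvar k).

(* Moments of the functional [p |-> L (p * (X^T M X))]. *)
Definition reweight (n : nat) (L : mono -> R) (M : mat) : mono -> R :=
  fun a => lsum (idx n) (fun j => lsum (idx n) (fun k => M j k * L (mmul (mvar2 j k) a))).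

Definition moment (L : mono -> R) : mat := fun j k => L (mvar2 j k).

Lemma mmul_comm a b : mmul a b = mmul b a.
Proof. apply functional_extensionality; intros i; unfold mmul; lia. Qed.

Lemma mmul_assoc a b c : mmul a (mmul b c) = mmul (mmul a b) c.
Proof. apply functional_extensionality; intros i; unfold mmul; lia. Qed.

Lemma mvar2_sym j k : mvar2 j k = mvar2 k j.
Proof. apply mmul_comm. Qed.

Lemma mmul_mone_r a : mmul a mone = a.
Proof. apply functional_extensionality; intros i; unfold mmul, mone; lia. Qed.

Lemma mmul_mone_l a : mmul mone a = a.
Proof. reflexivity. Qed.

Lemma lsum_single {T} (x : T) f : lsum [x] f = f x.
Proof. rewrite lsum_cons, lsum_nil; ring. Qed.

Lemma mdeg_mmul n a b : mdeg n (mmul a b) = (mdeg n a + mdeg n b)%nat.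
Proof.
  unfold mdeg, mmul; generalize (seq 0 n) as l; induction l as [|i l IH]; simpl; lia.
Qed.

Lemma mdeg_mone n : mdeg n mone = 0%nat.
Proof. unfold mdeg; generalize (seq 0 n) as l; induction l as [|i l IH]; simpl; auto. Qed.

Lemma mdeg_mvar n j : (j < n)%nat -> mdeg n (mvar j) = 1%nat.
Proof.
  intros H; unfold mdeg, mvar.
  assert (G : forall k s, (s <= j < s + k)%nat ->
    fold_right Nat.add 0%nat (map (fun i => if Nat.eqb i j then 1%nat else 0%nat) (seq s k)) = 1%nat
    /\ forall s', (j < s')%nat ->
    fold_right Nat.add 0%nat (map (fun i => if Nat.eqb i j then 1%nat else 0%nat) (seq s' k)) = 0%nat).
  { assert (Z : forall k s', (j < s')%nat ->
      fold_right Nat.add 0%nat (map (fun i => if Nat.eqb i j then 1%nat else 0%nat) (seq s' k)) = 0%nat).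
    { induction k as [|k IH]; intros s' Hs; simpl; [reflexivity|].
      rewrite IH by lia; destruct (Nat.eqb_spec s' j); lia. }
    induction k as [|k IH]; intros s Hs; [lia|split; [|apply Z]]; simpl.
    destruct (Nat.eqb_spec s j) as [->|N]; [rewrite Z by lia; lia|].
    rewrite (proj1 (IH (S s) ltac:(lia))); lia. }
  apply (G n 0%nat); lia.
Qed.

Lemma mono_in_mmul n a b : mono_in n a -> mono_in n b -> mono_in n (mmul a b).
Proof. intros Ha Hb i Hi; unfold mmul; rewrite Ha, Hb by exact Hi; reflexivity. Qed.

Lemma mono_in_mvar n j : (j < n)%nat -> mono_in n (mvar j).
Proof. intros H i Hi; unfold mvar; destruct (Nat.eqb_spec i j); lia. Qed.

Lemma mono_in_mone n : mono_in n mone.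
Proof. intros i _; reflexivity. Qed.

Lemma mono_in_mvar2 n j k : (j < n)%nat -> (k < n)%nat -> mono_in n (mvar2 j k).
Proof. intros Hj Hk; apply mono_in_mmul; apply mono_in_mvar; assumption. Qed.

Lemma mdeg_mvar2 n j k : (j < n)%nat -> (k < n)%nat -> mdeg n (mvar2 j k) = 2%nat.
Proof. intros Hj Hk; unfold mvar2; rewrite mdeg_mmul, !mdeg_mvar by assumption; reflexivity. Qed.

Lemma lsum2_idx_ext n (f g : nat -> nat -> R) :
  (forall j k, (j < n)%nat -> (k < n)%nat -> f j k = g j k) ->
  lsum (idx n) (fun j => lsum (idx n) (fun k => f j k)) =
  lsum (idx n) (fun j => lsum (idx n) (fun k => g j k)).
Proof.
  intros H; apply lsum_ext; intros j Hj; apply lsum_ext; intros k Hk.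
  apply H; apply in_idx; assumption.
Qed.

Lemma mip_ext n A M M' : (forall j k, (j < n)%nat -> (k < n)%nat -> M j k = M' j k) ->
  mip n A M = mip n A M'.
Proof. intros H; apply lsum2_idx_ext; intros j k Hj Hk; rewrite H by assumption; reflexivity. Qed.

Lemma mip_lsum_r {T} n A (l : list T) (F : T -> mat) :
  mip n A (fun j k => lsum l (fun i => F i j k)) = lsum l (fun i => mip n A (F i)).
Proof.
  symmetry; unfold mip; rewrite lsum_swap; apply lsum_ext; intros j _.
  rewrite lsum_swap; apply lsum_ext; intros k _; rewrite lsum_scal; reflexivity.
Qed.

Lemma mip_comm n A M : mip n A M = mip n M A.
Proof. apply lsum2_idx_ext; intros; ring. Qed.

Lemma qf_mip n M v : qf n M v = mip n M (fun j k => v j * v k).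
Proof. apply lsum2_idx_ext; intros; ring. Qed.

Lemma reweight_mip n L M a : reweight n L M a = mip n M (fun j k => L (mmul (mvar2 j k) a)).
Proof. reflexivity. Qed.

Lemma reweight_mone n L M : reweight n L M mone = mip n M (moment L).
Proof. apply lsum2_idx_ext; intros; rewrite mmul_mone_r; reflexivity. Qed.

Lemma reweight_lsum {T} n L (l : list T) (F : T -> mat) a :
  reweight n L (fun j k => lsum l (fun i => F i j k)) a = lsum l (fun i => reweight n L (F i) a).
Proof.
  rewrite reweight_mip, mip_comm, mip_lsum_r; apply lsum_ext; intros; apply mip_comm.
Qed.

(** Multiplication by quadratic forms commutes, so a constraint or a measurement may be moved past
    an earlier conditioning. *)
Lemma reweight_comm n L M M' a : reweight n (reweight n L M) M' a = reweight n (reweight n L M') M a.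
Proof.
  transitivity (mip n M (fun j k => mip n M' (fun j' k' =>
                 L (mmul (mvar2 j k) (mmul (mvar2 j' k') a))))).
  - unfold reweight, mip.
    rewrite (lsum_ext (idx n) _ (fun j' => lsum (idx n) (fun j => lsum (idx n) (fun k' =>
       lsum (idx n) (fun k => M' j' k' * (M j k * L (mmul (mvar2 j k) (mmul (mvar2 j' k') a)))))))).
    2:{ intros j' _; rewrite lsum_swap; apply lsum_ext; intros k' _.
        rewrite <- lsum_scal; apply lsum_ext; intros j _; rewrite <- lsum_scal; reflexivity. }
    rewrite lsum_swap; apply lsum_ext; intros j _.
    rewrite (lsum_ext (idx n) _ (fun j' => lsum (idx n) (fun k => lsum (idx n) (fun k' =>
       M' j' k' * (M j k * L (mmul (mvar2 j k) (mmul (mvar2 j' k') a))))))) by (intros; apply lsum_swap).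
    rewrite lsum_swap; apply lsum_ext; intros k _.
    rewrite <- lsum_scal; apply lsum_ext; intros j' _; rewrite <- lsum_scal.
    apply lsum_ext; intros; ring.
  - rewrite reweight_mip; apply mip_ext; intros j k _ _.
    rewrite reweight_mip; apply mip_ext; intros j' k' _ _.
    rewrite !mmul_assoc, (mmul_comm (mvar2 j k)); reflexivity.
Qed.

Lemma pE_lsum L p : pE L p = lsum p (fun t => fst t * L (snd t)).
Proof. reflexivity. Qed.

Lemma lsum_pmul p q f :
  lsum (pmul p q) f = lsum p (fun t => lsum q (fun s => f (fst t * fst s, mmul (snd t) (snd s)))).
Proof.
  unfold pmul; rewrite lsum_flat_map; apply lsum_ext; intros t _; apply lsum_map.
Qed.

Definition linear_poly (n : nat) (v : vec) : Defs.poly := map (fun j => (v j, mvar j)) (idx n).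

Lemma pE_linear_poly_sq n L v Q :
  pE L (pmul (pmul (linear_poly n v) Q) (pmul (linear_poly n v) Q)) =
  lsum Q (fun t => lsum Q (fun s => fst t * fst s *
    qf n (fun j k => L (mmul (mvar2 j k) (mmul (snd t) (snd s)))) v)).
Proof.
  rewrite pE_lsum, lsum_pmul, lsum_pmul; unfold linear_poly; rewrite lsum_map.
  rewrite (lsum_ext (idx n) _ (fun j => lsum Q (fun t => lsum Q (fun s => lsum (idx n) (fun k =>
      fst t * fst s * (L (mmul (mvar2 j k) (mmul (snd t) (snd s))) * v j * v k)))))).
  - rewrite lsum_swap; apply lsum_ext; intros t _.
    rewrite lsum_swap; apply lsum_ext; intros s _.
    unfold qf; rewrite sumR_lsum, <- lsum_scal; apply lsum_ext; intros j _.
    rewrite sumR_lsum, <- lsum_scal; reflexivity.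
  - intros j _; apply lsum_ext; intros t _; rewrite lsum_pmul, lsum_map, lsum_swap.
    apply lsum_ext; intros s _; apply lsum_ext; intros k _; cbn [fst snd].
    replace (mmul (mmul (mvar j) (snd t)) (mmul (mvar k) (snd s)))
      with (mmul (mvar2 j k) (mmul (snd t) (snd s))).
    + ring.
    + apply functional_extensionality; intros i; unfold mvar2, mmul; lia.
Qed.

(** The positivity of [is_pseudoexp] without the normalisation, since the mass of a conditioned
    functional is the probability of its outcome. *)
Definition sos_nonneg (n s : nat) (L : mono -> R) : Prop :=
  forall Q, poly_deg_le n s Q -> 0 <= pE L (pmul Q Q).

Lemma poly_deg_le_linear_poly n s v Q : poly_deg_le n s Q -> poly_deg_le n (S s) (pmul (linear_poly n v) Q).
Proof.
  unfold poly_deg_le; rewrite !Forall_forall; intros H t Ht.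
  unfold pmul in Ht; apply in_flat_map in Ht; destruct Ht as (u & Hu & Ht).
  unfold linear_poly in Hu; apply in_map_iff in Hu; destruct Hu as (j & <- & Hj); apply in_idx in Hj.
  apply in_map_iff in Ht; destruct Ht as (q & <- & Hq); destruct (H q Hq) as [H1 H2].
  cbn [fst snd]; split; [apply mono_in_mmul; [apply mono_in_mvar|]; assumption|].
  rewrite mdeg_mmul, mdeg_mvar by exact Hj; lia.
Qed.

(* A PSD quadratic form is a sum of squares of linear forms, so multiplying by it
   costs one degree in the positivity of the functional. *)
Lemma sos_nonneg_reweight n s L M : symm n M -> psd n M ->
  sos_nonneg n (S s) L -> sos_nonneg n s (reweight n L M).
Proof.
  intros Ms Mp H Q HQ; destruct (psd_vectors n M Ms Mp) as [vs Hv].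
  replace (pE (reweight n L M) (pmul Q Q)) with
    (lsum vs (fun v => pE L (pmul (pmul (linear_poly n v) Q) (pmul (linear_poly n v) Q)))).
  - apply lsum_nonneg; intros v _; apply H, poly_deg_le_linear_poly, HQ.
  - rewrite (lsum_ext vs _ _ (fun v _ => pE_linear_poly_sq n L v Q)), lsum_swap, pE_lsum, lsum_pmul.
    apply lsum_ext; intros t _; rewrite lsum_swap; apply lsum_ext; intros s' _; cbn [fst snd].
    rewrite lsum_scal, reweight_mip, mip_comm, Hv; reflexivity.
Qed.

Lemma poly_deg_le_single n s a : mono_in n a -> (mdeg n a <= s)%nat -> poly_deg_le n s [(1, a)].
Proof. intros H1 H2; constructor; [split; assumption|constructor]. Qed.

Lemma symm_moment n L : symm n (moment L).
Proof. intros j k _ _; unfold moment; rewrite mvar2_sym; reflexivity. Qed.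

Lemma psd_moment n s L : sos_nonneg n (S s) L -> psd n (moment L).
Proof.
  intros H v.
  assert (HQ : poly_deg_le n s [(1, mone)]).
  { apply poly_deg_le_single; [apply mono_in_mone|rewrite mdeg_mone; lia]. }
  pose proof (H _ (poly_deg_le_linear_poly n s v _ HQ)) as G.
  rewrite pE_linear_poly_sq, !lsum_single in G; cbn [fst snd] in G.
  rewrite !Rmult_1_l, mmul_mone_l in G; eapply Rle_trans; [exact G|]; apply Req_le.
  apply lsum2_idx_ext; intros; rewrite mmul_mone_r; reflexivity.
Qed.

(** The constraint [X^T M X = c], tested on multipliers of degree at most [D]. *)
Definition scales (n D : nat) (L : mono -> R) (M : mat) (c : R) : Prop :=
  forall a, mono_in n a -> (mdeg n a <= D)%nat -> reweight n L M a = c * L a.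

Lemma scales_reweight n D L M c M' : scales n (S (S D)) L M c -> scales n D (reweight n L M') M c.
Proof.
  intros H a Ha Da; rewrite reweight_comm, !reweight_mip.
  transitivity (mip n M' (fun j k => c * L (mmul (mvar2 j k) a))).
  - apply mip_ext; intros j k Hj Hk; apply H.
    + apply mono_in_mmul; [apply mono_in_mvar2|]; assumption.
    + rewrite mdeg_mmul, mdeg_mvar2 by assumption; lia.
  - unfold mip; rewrite <- lsum_scal; apply lsum_ext; intros j _.
    rewrite <- lsum_scal; apply lsum_ext; intros; ring.
Qed.

(* The constraint [E, e] survives conditioning; in part (2) it is ||Y||^2 = 1/2, needed
   because [product_bound] is then only true when the two diagonal blocks have equal trace. *)
Section Conditioning.
Variables (n m : nat) (A B : nat -> mat) (E : mat) (e c th : R).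
Hypothesis n_pos : (1 <= n)%nat.
Hypothesis A_sym : forall i, (i < m)%nat -> symm n (A i).
Hypothesis A_le1 : forall i v, (i < m)%nat -> 0 <= qf n (A i) v /\ qf n (A i) v <= sqn n v.
Hypothesis B_sym : forall i, (i < m)%nat -> symm n (B i).
Hypothesis B_psd : forall i, (i < m)%nat -> psd n (B i).
Hypothesis product_bound : forall M, symm n M -> psd n M -> mip n E M = e * trace n M ->
  lsum (idx m) (fun i => mip n (A i) M * mip n (B i) M) <= c * (trace n M * trace n M).
Hypothesis th_pos : 0 < th.

Definition Bsum : mat := fun j k => lsum (idx m) (fun i => B i j k).

(** Here [k] is the number of conditionings still affordable. Each costs one degree of positivity
    and two degrees in the constraints; the extra [S] keeps the matrix of second moments PSD when
    none is left. *)
Record conditionable (k : nat) (L : mono -> R) : Prop := {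
  cond_sos : sos_nonneg n (S k) L;
  cond_norm : scales n (2 * k) L delta 1;
  cond_meas : scales n (2 * k) L Bsum 1;
  cond_extra : scales n (2 * k) L E e }.

Lemma conditionable_reweight k L M : symm n M -> psd n M ->
  conditionable (S k) L -> conditionable k (reweight n L M).
Proof.
  intros Ms Mp [H1 H2 H3 H4]; split.
  - apply sos_nonneg_reweight; assumption.
  - apply scales_reweight; replace (S (S (2 * k))) with (2 * S k)%nat by lia; exact H2.
  - apply scales_reweight; replace (S (S (2 * k))) with (2 * S k)%nat by lia; exact H3.
  - apply scales_reweight; replace (S (S (2 * k))) with (2 * S k)%nat by lia; exact H4.
Qed.

Lemma scales_mone D L M x : scales n D L M x -> mip n M (moment L) = x * L mone.
Proof.
  intros H; rewrite <- reweight_mone; apply H; [apply mono_in_mone|rewrite mdeg_mone; lia].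
Qed.

Lemma cond_trace k L : conditionable k L -> trace n (moment L) = L mone.
Proof. intros H; rewrite <- mip_delta, (scales_mone _ _ _ _ (cond_norm k L H)); ring. Qed.

Lemma cond_frame k L : conditionable k L -> exists fr, eigenframe n (moment L) fr.
Proof.
  intros H; apply eigenframe_exists; [apply symm_moment|apply (psd_moment n k), (cond_sos k L H)].
Qed.

(** This is [L] applied to the sum of the [A_i B_i]: the observable [A_i] is tested on the
    unnormalised posterior after outcome [i]. *)
Definition value (L : mono -> R) : R :=
  lsum (idx m) (fun i => mip n (A i) (moment (reweight n L (B i)))).

Lemma cond_split D L : scales n D L Bsum 1 ->
  forall a, mono_in n a -> (mdeg n a <= D)%nat ->
  lsum (idx m) (fun i => reweight n L (B i) a) = L a.
Proof. intros H a Ha Da; rewrite <- reweight_lsum; fold Bsum; rewrite (H a Ha Da); ring. Qed.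

(** The martingale property: conditioning on one more outcome leaves the average of [value]
    unchanged. The measurement identity is needed against quadratic monomials after one
    conditioning, hence two levels. *)
Lemma value_split k L : conditionable (S (S k)) L ->
  lsum (idx m) (fun i => value (reweight n L (B i))) = value L.
Proof.
  intros H; unfold value; rewrite lsum_swap; apply lsum_ext; intros i Hi; apply in_idx in Hi.
  rewrite <- mip_lsum_r; apply mip_ext; intros j k' Hj Hk; unfold moment.
  pose proof (conditionable_reweight _ L (B i) (B_sym i Hi) (B_psd i Hi) H) as Hc.
  rewrite (lsum_ext _ _ (fun i' => reweight n (reweight n L (B i)) (B i') (mvar2 j k')))
    by (intros; apply reweight_comm).
  apply (cond_split (2 * S k) _ (cond_meas _ _ Hc)); [apply mono_in_mvar2; assumption|].
  rewrite mdeg_mvar2 by assumption; lia.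
Qed.

(** By linearity the posteriors may be added inside the form, and they add up to the prior. The
    divergences of one step thus sum to a difference of potentials. *)
Lemma cross_potential_sum k L fr : conditionable (S k) L -> eigenframe n (moment L) fr -> 0 < L mone ->
  lsum (idx m) (fun i => cross_potential n (L mone) fr (reweight n L (B i) mone) (moment (reweight n L (B i)))) =
  potential n (L mone) fr.
Proof.
  intros H Hf Pp; unfold cross_potential, potential; rewrite lsum_swap; apply lsum_ext; intros t Ht.
  rewrite lsum_scal, lsum_plus.
  assert (E1 : lsum (idx m) (fun i => qf n (moment (reweight n L (B i))) (snd t)) = fst t * sqn n (snd t)).
  { rewrite <- (frame_qf_eigen n (moment L) fr t Hf Ht), qf_mip, mip_comm.
    rewrite (lsum_ext _ _ (fun i => mip n (fun j k => snd t j * snd t k) (moment (reweight n L (B i)))))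
      by (intros; rewrite qf_mip, mip_comm; reflexivity).
    rewrite <- mip_lsum_r; apply mip_ext; intros j k' Hj Hk; unfold moment.
    apply (cond_split _ _ (cond_meas _ _ H)); [apply mono_in_mvar2; assumption|].
    rewrite mdeg_mvar2 by assumption; lia. }
  assert (E2 : lsum (idx m) (fun i => reweight n L (B i) mone / INR n * sqn n (snd t)) =
               L mone / INR n * sqn n (snd t)).
  { rewrite lsum_scal_r; unfold Rdiv; rewrite lsum_scal_r.
    rewrite (cond_split _ _ (cond_meas _ _ H)); [reflexivity|apply mono_in_mone|].
    rewrite mdeg_mone; lia. }
  rewrite E1, E2; ring.
Qed.

(** Instead of selecting a good step, all [k] Pinsker inequalities along the tree of outcomes are
    added, each bounding one copy of [value]. Keeping the mass [L mone] arbitrary lets the bounds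
    for the branches be summed directly, and the potential of the root records the entropy still
    available. *)
Lemma value_bound k : forall L fr, conditionable k L -> eigenframe n (moment L) fr ->
  INR k * value L <= INR k * (c + th) * L mone +
    2 / th * (2 * L mone * ln (1 + / INR n) - potential n (L mone) fr).
Proof.
  assert (Pt : 0 < 2 / th) by (apply Rmult_lt_0_compat; [lra|apply Rinv_0_lt_compat, th_pos]).
  induction k as [|k IH]; intros L fr H Hf; pose proof (cond_trace _ _ H) as Tr;
    pose proof (psd_trace_nonneg n _ fr Hf) as P0; rewrite Tr in P0.
  - destruct (Rle_lt_or_eq_dec _ _ P0) as [Pp|Z].
    + pose proof (potential_upper n _ fr _ n_pos Hf Tr Pp) as U.
      simpl INR; rewrite !Rmult_0_l, Rplus_0_l; apply Rmult_le_pos; lra.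
    + rewrite <- Z in Tr |- *; rewrite (potential_trace0 n _ fr Hf Tr); simpl INR; lra.
  - assert (Hc : forall i, (i < m)%nat -> conditionable k (reweight n L (B i)))
      by (intros i Hi; apply conditionable_reweight; auto).
    assert (Ps : lsum (idx m) (fun i => reweight n L (B i) mone) = L mone).
    { apply (cond_split _ _ (cond_meas _ _ H)); [apply mono_in_mone|rewrite mdeg_mone; lia]. }
    assert (Pi : forall i, In i (idx m) -> 0 <= reweight n L (B i) mone).
    { intros i Hi; apply in_idx in Hi; destruct (cond_frame _ _ (Hc i Hi)) as [fi Hfi].
      rewrite <- (cond_trace _ _ (Hc i Hi)); apply (psd_trace_nonneg n _ fi Hfi). }
    destruct (Rle_lt_or_eq_dec _ _ P0) as [Pp|Z].
    (* For each outcome the induction hypothesis and Pinsker's inequality are added; the potential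
       of the posterior occurs with opposite signs and drops out. *)
    + assert (Step : lsum (idx m) (fun i => INR k * value (reweight n L (B i)) +
          (mip n (A i) (moment (reweight n L (B i))) -
           reweight n L (B i) mone / L mone * mip n (A i) (moment L))) <=
        lsum (idx m) (fun i => (INR k * (c + th) + th + 2 / th * (2 * ln (1 + / INR n))) * reweight n L (B i) mone
          - 2 / th * cross_potential n (L mone) fr (reweight n L (B i) mone) (moment (reweight n L (B i))))).
      { apply lsum_le; intros i Hi; apply in_idx in Hi.
        destruct (cond_frame _ _ (Hc i Hi)) as [fi Hfi].
        pose proof (IH _ fi (Hc i Hi) Hfi) as I1.
        pose proof (pinsker_step_ge0 n (A i) (moment (reweight n L (B i))) (moment L) fi fr th
          (L mone) (reweight n L (B i) mone) n_pos (A_sym i Hi) (fun v => A_le1 i v Hi) Hfi Hf th_pos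
          Tr (cond_trace _ _ (Hc i Hi)) Pp (psd_moment n k _ (cond_sos _ _ (Hc i Hi)))) as I2.
        lra. }
      rewrite lsum_plus, !lsum_minus, !lsum_scal, Ps, (cross_potential_sum k L fr H Hf Pp) in Step.
      assert (Kv : INR k * lsum (idx m) (fun i => value (reweight n L (B i))) = INR k * value L).
      (* With only one level left [value_split] does not apply, but its coefficient is then 0. *)
      { destruct k as [|k]; [simpl INR; ring|rewrite (value_split k L H); reflexivity]. }
      rewrite Kv in Step; fold (value L) in Step.
      assert (F2 : lsum (idx m) (fun i => reweight n L (B i) mone / L mone * mip n (A i) (moment L)) <= c * L mone).
      { pose proof (product_bound (moment L) (symm_moment n L) (psd_moment n _ _ (cond_sos _ _ H))) as F.
        rewrite Tr in F; specialize (F (scales_mone _ _ _ _ (cond_extra _ _ H))).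
        apply (Rmult_le_compat_l (/ L mone)) in F; [|apply Rlt_le, Rinv_0_lt_compat, Pp].
        replace (/ L mone * (c * (L mone * L mone))) with (c * L mone) in F by (field; lra).
        eapply Rle_trans; [|exact F]; apply Req_le; rewrite <- lsum_scal; apply lsum_ext; intros i _.
        rewrite reweight_mone; unfold Rdiv; ring. }
      rewrite S_INR; lra.
    + rewrite <- Z in *; rewrite (potential_trace0 n _ fr Hf Tr).
      (* At mass zero each term is at most the mass of its posterior, and these masses sum to 0. *)
      assert (V : value L <= 0).
      { unfold value; rewrite <- Ps; apply lsum_le; intros i Hi; apply in_idx in Hi.
        destruct (cond_frame _ _ (Hc i Hi)) as [fi Hfi].
        rewrite <- (cond_trace _ _ (Hc i Hi)); apply (mip_le_trace n _ _ fi Hfi).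
        intros v; apply A_le1, Hi. }
      assert (INR (S k) * value L <= INR (S k) * 0) by (apply Rmult_le_compat_l; [apply pos_INR|exact V]).
      lra.
Qed.

Lemma conditioning_bound k L : (1 <= k)%nat -> conditionable k L -> L mone = 1 ->
  value L <= c + th + 4 * ln (INR n) / (th * INR k).
Proof.
  intros Hk H H1; destruct (cond_frame _ _ H) as [fr Hf].
  pose proof (value_bound k L fr H Hf) as V.
  assert (Tr : trace n (moment L) = 1) by (rewrite (cond_trace _ _ H); exact H1).
  pose proof (potential_lower n _ fr 1 n_pos Hf Tr Rlt_0_1) as Lo.
  rewrite H1 in V; pose proof (dim_pos n n_pos) as Pn.
  assert (Pk : 0 < INR k) by (apply lt_0_INR; lia).
  assert (N1 : 1 <= INR n) by (replace 1 with (INR 1) by reflexivity; apply le_INR, n_pos).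
  (* At mass 1 the extreme potentials differ by [2 * ln ((n + 1) / 2)], at most [2 * ln n] as
     [n >= 1]; the factor [2 / th] makes this the 4 of the statement. *)
  assert (Ln : ln (1 + / INR n) - ln (2 / INR n) <= ln (INR n)).
  { assert (Hin : 0 < / INR n) by (apply Rinv_0_lt_compat; exact Pn).
    replace (1 + / INR n) with ((INR n + 1) / 2 * (2 / INR n)) by (field; lra).
    rewrite ln_mult; [|lra|unfold Rdiv; lra].
    assert (ln ((INR n + 1) / 2) <= ln (INR n)); [|lra].
    destruct (Req_dec (INR n) 1) as [->|Ne]; [apply Req_le; f_equal; lra|].
    apply Rlt_le, ln_increasing; lra. }
  apply Rmult_le_reg_l with (INR k); [exact Pk|].
  replace (INR k * (c + th + 4 * ln (INR n) / (th * INR k)))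
    with (INR k * (c + th) + 2 / th * (2 * ln (INR n))) by (field; lra).
  eapply Rle_trans; [exact V|].
  assert (Pt : 0 < 2 / th) by (apply Rmult_lt_0_compat; [lra|apply Rinv_0_lt_compat, th_pos]).
  assert (2 / th * (2 * 1 * ln (1 + / INR n) - potential n 1 fr) <= 2 / th * (2 * ln (INR n)))
    by (apply Rmult_le_compat_l; lra).
  lra.
Qed.
End Conditioning.

(** * Quadratic forms as polynomials *)

Lemma lsum_quad n M f :
  lsum (quad n M) f = lsum (idx n) (fun j => lsum (idx n) (fun k => f (M j k, mvar2 j k))).
Proof.
  unfold quad, psum, psum_from; rewrite lsum_flat_map; apply lsum_ext; intros j _.
  rewrite lsum_flat_map; apply lsum_ext; intros k _.
  cbn [pmul pvar pscale flat_map map app fst snd]; rewrite lsum_single; cbn [fst snd].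
  f_equal; f_equal; ring.
Qed.

Lemma pE_Ppoly n m A B L :
  pE L (Ppoly n m A B) = lsum (idx m) (fun i => mip n (A i) (moment (reweight n L (B i)))).
Proof.
  unfold Ppoly, psum, psum_from; rewrite pE_lsum, lsum_flat_map; apply lsum_ext; intros i _.
  rewrite lsum_pmul, lsum_quad; apply lsum2_idx_ext; intros j k _ _.
  rewrite lsum_quad; unfold moment, reweight; rewrite <- lsum_scal; apply lsum_ext; intros l _.
  rewrite <- lsum_scal; apply lsum_ext; intros r _; cbn [fst snd].
  rewrite mmul_comm; ring.
Qed.

Definition meval (n : nat) (a : mono) (x : vec) : R :=
  fold_right Rmult 1 (map (fun i => x i ^ a i) (seq 0 n)).

Lemma meval_mmul n a b x : meval n (mmul a b) x = meval n a x * meval n b x.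
Proof.
  unfold meval, mmul; generalize (seq 0 n) as l.
  induction l as [|i l IH]; cbn [map fold_right]; [ring|].
  rewrite IH, pow_add; ring.
Qed.

Lemma meval_mvar n j x : (j < n)%nat -> meval n (mvar j) x = x j.
Proof.
  intros H; unfold meval, mvar.
  assert (Z : forall k s, (j < s)%nat ->
    fold_right Rmult 1 (map (fun i => x i ^ (if Nat.eqb i j then 1 else 0)) (seq s k)) = 1).
  { induction k as [|k IH]; intros s Hs; cbn [seq map fold_right]; [reflexivity|].
    rewrite IH by lia; destruct (Nat.eqb_spec s j); [lia|simpl; ring]. }
  assert (G : forall k s, (s <= j < s + k)%nat ->
    fold_right Rmult 1 (map (fun i => x i ^ (if Nat.eqb i j then 1 else 0)) (seq s k)) = x j).
  { induction k as [|k IH]; intros s Hs; [lia|]; cbn [seq map fold_right].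
    destruct (Nat.eqb_spec s j) as [->|N]; [rewrite Z by lia; simpl; ring|].
    rewrite IH by lia; simpl; ring. }
  apply G; lia.
Qed.

Lemma peval_Ppoly n m A B x :
  peval n (Ppoly n m A B) x = lsum (idx m) (fun i => qf n (A i) x * qf n (B i) x).
Proof.
  change (peval n (Ppoly n m A B) x)
    with (lsum (Ppoly n m A B) (fun t => fst t * meval n (snd t) x)).
  unfold Ppoly, psum, psum_from; rewrite lsum_flat_map; apply lsum_ext; intros i _.
  rewrite lsum_pmul, lsum_quad; unfold qf; rewrite sumR_lsum, <- lsum_scal_r.
  apply lsum_ext; intros j Hj; rewrite sumR_lsum, <- lsum_scal_r.
  apply lsum_ext; intros k Hk; rewrite lsum_quad, sumR_lsum, <- lsum_scal.
  apply lsum_ext; intros l Hl; rewrite sumR_lsum, <- lsum_scal.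
  apply lsum_ext; intros r Hr; apply in_idx in Hj, Hk, Hl, Hr; cbn [fst snd]; unfold mvar2.
  rewrite !meval_mmul, !meval_mvar by assumption; ring.
Qed.

(** The hypotheses only concern quadratic forms, while eigenframes need symmetric matrices.
    Replacing a matrix by its symmetric part changes neither its form nor its reweighting. *)
Definition symmetrize (M : mat) : mat := fun j k => (M j k + M k j) / 2.

Lemma symm_symmetrize n M : symm n (symmetrize M).
Proof. intros j k _ _; unfold symmetrize; field. Qed.

Lemma mip_symmetrize n A M : symm n M -> mip n (symmetrize A) M = mip n A M.
Proof.
  intros H; transitivity ((mip n A M + mip n (fun j k => A k j) M) / 2).
  - unfold mip, Rdiv; rewrite <- lsum_plus, <- lsum_scal_r; apply lsum_ext; intros j _.
    rewrite <- lsum_plus, <- lsum_scal_r; apply lsum_ext; intros k _; unfold symmetrize; field.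
  - replace (mip n (fun j k => A k j) M) with (mip n A M); [field|].
    unfold mip; rewrite lsum_swap; apply lsum2_idx_ext; intros j k Hj Hk.
    rewrite (H j k Hj Hk); reflexivity.
Qed.

Lemma qf_symmetrize n A v : qf n (symmetrize A) v = qf n A v.
Proof. rewrite !qf_mip; apply mip_symmetrize; intros j k _ _; ring. Qed.

Lemma reweight_symmetrize n L M : reweight n L (symmetrize M) = reweight n L M.
Proof.
  apply functional_extensionality; intros a; rewrite !reweight_mip; apply mip_symmetrize.
  intros j k _ _; rewrite mvar2_sym; reflexivity.
Qed.

Lemma mip_scal_l n x A M : mip n (fun j k => x * A j k) M = x * mip n A M.
Proof.
  unfold mip; rewrite <- lsum_scal; apply lsum_ext; intros j _.
  rewrite <- lsum_scal; apply lsum_ext; intros; ring.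
Qed.

(** * Completing the forms to a measurement *)

Lemma lsum_idx_S m f : lsum (idx (S m)) f = lsum (idx m) f + f m.
Proof. unfold idx; rewrite seq_S, lsum_app, lsum_single; reflexivity. Qed.

(* The extra outcome [m] makes the matrices sum to [x * T]. *)
Definition complete (m : nat) (x : R) (T : mat) (B : nat -> mat) : nat -> mat := fun i =>
  if (i <? m)%nat then (fun j k => x * B i j k)
  else (fun j k => x * (T j k - lsum (idx m) (fun i' => B i' j k))).

(** The extra outcome is paired with the zero form, so it contributes nothing to [value]. *)
Definition extend0 (m : nat) (A : nat -> mat) : nat -> mat := fun i =>
  if (i <? m)%nat then A i else (fun _ _ => 0).

Lemma lsum_complete {m x T B} (f : nat -> mat -> R) :
  lsum (idx m) (fun i => f i (complete m x T B i)) = lsum (idx m) (fun i => f i (fun j k => x * B i j k)).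
Proof.
  apply lsum_ext; intros i Hi; apply in_idx in Hi; unfold complete.
  destruct (Nat.ltb_spec i m); [reflexivity|lia].
Qed.

Section Completion.
Variables (n m k : nat) (A B : nat -> mat) (T E : mat) (x e c th : R) (L : mono -> R).
Hypothesis n_pos : (1 <= n)%nat.
Hypothesis k_pos : (1 <= k)%nat.
Hypothesis A_sym : forall i, (i < m)%nat -> symm n (A i).
Hypothesis A_le1 : forall i v, (i < m)%nat -> 0 <= qf n (A i) v /\ qf n (A i) v <= sqn n v.
Hypothesis B_sym : forall i, (i < m)%nat -> symm n (B i).
Hypothesis B_psd : forall i v, (i < m)%nat -> 0 <= qf n (B i) v.
Hypothesis T_sym : symm n T.
Hypothesis B_sum : forall v, lsum (idx m) (fun i => qf n (B i) v) <= qf n T v.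
Hypothesis x_pos : 0 < x.
Hypothesis product_bound : forall M, symm n M -> psd n M -> mip n E M = e * trace n M ->
  lsum (idx m) (fun i => mip n (A i) M * mip n (B i) M) <= c * (trace n M * trace n M).
Hypothesis th_pos : 0 < th.
Hypothesis L_one : L mone = 1.
Hypothesis L_sos : sos_nonneg n (S k) L.
Hypothesis L_norm : scales n (2 * k) L delta 1.
Hypothesis L_meas : scales n (2 * k) L T (/ x).
Hypothesis L_extra : scales n (2 * k) L E e.

(** The constraint gives [T] the value [/ x], so scaling by [x] makes the completed forms sum to 1
    modulo the constraint. This scaling multiplies both the value and the constant [c], but not the
    error terms. *)
Lemma completed_bound :
  x * lsum (idx m) (fun i => mip n (A i) (moment (reweight n L (B i)))) <=
  x * c + th + 4 * ln (INR n) / (th * INR k).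
Proof.
  assert (Bs : Bsum (S m) (complete m x T B) = (fun j k => x * T j k)).
  { apply functional_extensionality; intros j; apply functional_extensionality; intros l.
    unfold Bsum; rewrite lsum_idx_S, (lsum_complete (fun _ M => M j l)), lsum_scal.
    unfold complete; rewrite Nat.ltb_irrefl; ring. }
  assert (Q : forall M v, qf n (fun j k => x * M j k) v = x * qf n M v)
    by (intros; rewrite !qf_mip; apply mip_scal_l).
  (* The form of the extra outcome before scaling, whose nonnegativity is exactly [B_sum]. *)
  assert (Hlast : forall v, qf n (fun j k => T j k - lsum (idx m) (fun i => B i j k)) v =
                        qf n T v - lsum (idx m) (fun i => qf n (B i) v)).
  { intros v; rewrite !qf_mip, (lsum_ext (idx m) _ (fun i => mip n (fun j k => v j * v k) (B i)))
      by (intros; rewrite qf_mip, mip_comm; reflexivity).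
    rewrite <- mip_lsum_r, (mip_comm n _ (fun j k => lsum _ _)); unfold mip; rewrite <- lsum_minus.
    apply lsum_ext; intros j _; rewrite <- lsum_minus; apply lsum_ext; intros; ring. }
  pose proof (conditioning_bound n (S m) (extend0 m A) (complete m x T B) E e (x * c) th) as C.
  assert (V : value n (S m) (extend0 m A) (complete m x T B) L =
              x * lsum (idx m) (fun i => mip n (A i) (moment (reweight n L (B i))))).
  { unfold value; rewrite lsum_idx_S; unfold extend0 at 2; rewrite Nat.ltb_irrefl.
    replace (mip n (fun _ _ => 0) _) with 0
      by (symmetry; apply lsum_eq0; intros; apply lsum_eq0; intros; ring).
    rewrite Rplus_0_r, (lsum_complete (fun i M => mip n (extend0 m A i) (moment (reweight n L M)))), <- lsum_scal.
    apply lsum_ext; intros i Hi; apply in_idx in Hi; unfold extend0.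
    destruct (Nat.ltb_spec i m); [|lia].
    rewrite <- mip_scal_l, mip_comm, (mip_comm n (fun j k => x * A i j k)).
    unfold mip; apply lsum2_idx_ext; intros j l _ _; unfold moment at 1.
    rewrite reweight_mip, mip_scal_l; unfold moment; rewrite reweight_mip; ring. }
  rewrite <- V; apply C; clear C; try assumption.
  - intros i _ j l Hj Hl; unfold extend0; destruct (Nat.ltb_spec i m); [apply A_sym|]; auto.
  - intros i v _; unfold extend0; destruct (Nat.ltb_spec i m); [auto|].
    replace (qf n (fun _ _ => 0) v) with 0
      by (symmetry; apply lsum_eq0; intros; apply lsum_eq0; intros; ring).
    split; [lra|apply sqn_nonneg].
  - intros i _ j l Hj Hl; unfold complete; destruct (Nat.ltb_spec i m).
    + rewrite (B_sym i) by assumption; reflexivity.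
    + rewrite (T_sym j l) by assumption; f_equal; f_equal; apply lsum_ext; intros i' Hi'.
      apply B_sym; try assumption; apply in_idx, Hi'.
  - intros i _ v; unfold complete; destruct (Nat.ltb_spec i m).
    + rewrite Q; apply Rmult_le_pos; [lra|auto].
    + rewrite Q, Hlast; apply Rmult_le_pos; [lra|]; pose proof (B_sum v); lra.
  - intros M Ms Mp ME; rewrite lsum_idx_S; unfold extend0 at 2; rewrite Nat.ltb_irrefl.
    replace (mip n (fun _ _ => 0) M) with 0
      by (symmetry; apply lsum_eq0; intros; apply lsum_eq0; intros; ring).
    rewrite (lsum_complete (fun i M' => mip n (extend0 m A i) M * mip n M' M)).
    rewrite (lsum_ext (idx m) _ (fun i => x * (mip n (A i) M * mip n (B i) M))).
    + rewrite lsum_scal, Rmult_0_l, Rplus_0_r, Rmult_assoc; apply Rmult_le_compat_l; [lra|].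
      apply product_bound; assumption.
    + intros i Hi; apply in_idx in Hi; unfold extend0; destruct (Nat.ltb_spec i m); [|lia].
      rewrite mip_scal_l; ring.
  - split; try assumption; rewrite Bs; intros a Ha Da.
    rewrite reweight_mip, mip_scal_l, <- reweight_mip, (L_meas a Ha Da); field; lra.
Qed.
End Completion.

(** * Sphere constraints, the norm of P and the choice of constants *)

Lemma lsum_constraint k0 k c a L :
  pE L (pmul (psub (sqnorm_from k0 k) (pconst c)) [(1, a)]) =
  lsum (seq k0 k) (fun j => L (mmul (mvar2 j j) a)) - c * L a.
Proof.
  rewrite pE_lsum, lsum_pmul; unfold psub, padd, pconst, pscale; rewrite lsum_app, lsum_map, lsum_single.
  rewrite !lsum_single; cbn [fst snd]; rewrite mmul_mone_l.
  unfold sqnorm_from, psum_from; rewrite lsum_flat_map.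
  rewrite (lsum_ext (seq k0 k) _ (fun j => L (mmul (mvar2 j j) a))); [ring|].
  intros j _; cbn [pmul pvar flat_map map app]; rewrite !lsum_single; cbn [fst snd].
  rewrite !Rmult_1_l; reflexivity.
Qed.

Lemma reweight_delta n L a : reweight n L delta a = lsum (seq 0 n) (fun j => L (mmul (mvar2 j j) a)).
Proof. apply lsum_ext; intros j Hj; apply in_idx in Hj; apply lsum_delta_l, Hj. Qed.

Lemma reweight_delta_lo n p L a : (p <= n)%nat ->
  reweight n L (delta_lo p) a = lsum (seq 0 p) (fun j => L (mmul (mvar2 j j) a)).
Proof.
  intros H; unfold reweight, idx at 1; replace n with (p + (n - p))%nat at 1 by lia.
  rewrite seq_app, lsum_app, (lsum_eq0 (seq (0 + p) _)), Rplus_0_r.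
  - apply lsum_ext; intros j Hj; apply in_seq in Hj; unfold delta_lo.
    destruct (Nat.ltb_spec j p); [apply lsum_delta_l|]; lia.
  - intros j Hj; apply in_seq in Hj; apply lsum_eq0; intros; unfold delta_lo.
    destruct (Nat.ltb_spec j p); [lia|ring].
Qed.

Lemma reweight_delta_hi n p L a : (p <= n)%nat ->
  reweight n L (delta_hi p) a = lsum (seq p (n - p)) (fun j => L (mmul (mvar2 j j) a)).
Proof.
  intros H; unfold reweight, idx at 1; replace n with (p + (n - p))%nat at 1 by lia.
  rewrite seq_app, lsum_app, (lsum_eq0 (seq 0 p)), Rplus_0_l.
  - apply lsum_ext; intros j Hj; apply in_seq in Hj; unfold delta_hi.
    destruct (Nat.ltb_spec j p); [|apply lsum_delta_l]; lia.
  - intros j Hj; apply in_seq in Hj; apply lsum_eq0; intros; unfold delta_hi.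
    destruct (Nat.ltb_spec j p); [ring|lia].
Qed.

Lemma mip_delta_lo_hi n p M : mip n (delta_lo p) M + mip n (delta_hi p) M = trace n M.
Proof.
  rewrite <- mip_delta; unfold mip; rewrite <- lsum_plus; apply lsum_ext; intros j _.
  rewrite <- lsum_plus; apply lsum_ext; intros k _; unfold delta_lo, delta_hi.
  destruct (j <? p)%nat; ring.
Qed.

Lemma symm_delta_hi n p : symm n (delta_hi p).
Proof.
  intros j k _ _; unfold delta_hi, delta.
  destruct (Nat.ltb_spec j p), (Nat.ltb_spec k p), (Nat.eqb_spec j k), (Nat.eqb_spec k j);
    try reflexivity; lia.
Qed.

(** Homogeneity of degree four extends the bound from the unit sphere; where the norm is 0,
    [A_i <= ||X||^2] makes every term vanish. The unit vector [delta 0], which exists as [n >= 1],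
    shows that [N] is nonnegative. *)
Lemma sphere_bound n m A B N : (1 <= n)%nat ->
  (forall i v, (i < m)%nat -> 0 <= qf n (A i) v /\ qf n (A i) v <= sqn n v) ->
  (forall x, sqn n x = 1 -> Rabs (lsum (idx m) (fun i => qf n (A i) x * qf n (B i) x)) <= N) ->
  0 <= N /\
  forall x, lsum (idx m) (fun i => qf n (A i) x * qf n (B i) x) <= N * (sqn n x * sqn n x).
Proof.
  intros Hn HA HN; split.
  - apply Rle_trans with (Rabs (lsum (idx m) (fun i => qf n (A i) (delta 0) * qf n (B i) (delta 0))));
      [apply Rabs_pos|apply HN].
    unfold sqn; rewrite sumR_lsum, lsum_delta_l by lia; unfold delta; reflexivity.
  - intros x; destruct (Req_dec (sqn n x) 0) as [Z|Z].
    + rewrite Z, lsum_eq0; [lra|]; intros i Hi; apply in_idx in Hi.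
      destruct (HA i x Hi); replace (qf n (A i) x) with 0 by lra; ring.
    + pose proof (sqn_nonneg n x) as P; set (s := sqn n x) in *; assert (Ps : 0 < s) by lra.
      assert (Ss : sqrt (/ s) * sqrt (/ s) = / s)
        by (apply sqrt_sqrt, Rlt_le, Rinv_0_lt_compat, Ps).
      assert (U : sqn n (fun j => sqrt (/ s) * x j) = 1).
      { rewrite <- qf_delta, qf_scale, Ss, qf_delta; fold s; field; lra. }
      pose proof (Rle_trans _ _ _ (Rle_abs _) (HN _ U)) as H.
      rewrite (lsum_ext (idx m) _ (fun i => / s * / s * (qf n (A i) x * qf n (B i) x))) in H
        by (intros; rewrite !qf_scale, Ss; ring).
      rewrite lsum_scal in H; apply (Rmult_le_compat_l (s * s)) in H; [|nra].
      set (t := lsum _ _) in *.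
      replace (s * s * (/ s * / s * t)) with t in H by (field; lra); lra.
Qed.

(** The choice is [k = d / 2 - 1]: one degree of positivity is kept for the last moment matrix, and
    constraints tested up to degree [2 * k] fit into [d - 2]. Here [d <= 2 * k + 3], so 8 is a
    comfortable ratio for [k >= 1]. *)
Lemma half_degree d : (4 <= d)%nat ->
  exists k, (1 <= k)%nat /\ S k = (d / 2)%nat /\ (2 * k <= d - 2)%nat /\ INR d <= 8 * INR k.
Proof.
  intros Hd; exists (d / 2 - 1)%nat.
  pose proof (Nat.div_mod_eq d 2) as Eq; pose proof (Nat.mod_upper_bound d 2 ltac:(lia)) as Lt.
  repeat split; try lia.
  replace 8 with (INR 8) by (simpl; ring); rewrite <- mult_INR; apply le_INR; lia.
Qed.

Theorem theoremC1 :
  exists K : R, 0 < K /\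
  forall (eps : R), 0 < eps < 1 ->
  forall (n m d : nat) (A B : nat -> nat -> nat -> R) (normP : R),
    (1 <= n)%nat ->
    (4 <= d)%nat ->
    (* 0 <= A_i <= ||X||^2,  B_i >= 0,  sum_i B_i <= ||X||^2  (Loewner order) *)
    (forall i v, (i < m)%nat -> 0 <= qf n (A i) v /\ qf n (A i) v <= sqn n v) ->
    (forall i v, (i < m)%nat -> 0 <= qf n (B i) v) ->
    (forall v, sumR m (fun i => qf n (B i) v) <= sqn n v) ->
    (* normP = max_{||x|| = 1} |P(x)| *)
    is_lub (fun r => exists x : nat -> R, sqn n x = 1 /\ r = Rabs (peval n (Ppoly n m A B) x))
           normP ->
    K * ln (INR n) / (eps ^ 2) <= INR d ->
    (* (1) *)
    (forall L : mono -> R,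
       is_pseudoexp n d L ->
       (forall Q, poly_deg_le n (d - 2) Q ->
          pE L (pmul (psub (sqnorm n) (pconst 1)) Q) = 0) ->
       pE L (Ppoly n m A B) <= 3 * normP + eps) /\
    (* (2) X = (Y, Z), Y = (X_0..X_{p-1}), Z = (X_p..X_{n-1}) *)
    (forall p : nat, (p <= n)%nat ->
       (forall i j k, (i < m)%nat -> (p <= j \/ p <= k)%nat -> A i j k = 0) ->
       (forall i j k, (i < m)%nat -> (j < p \/ k < p)%nat -> B i j k = 0) ->
       forall L : mono -> R,
       is_pseudoexp n d L ->
       (forall Q, poly_deg_le n (d - 2) Q ->
          pE L (pmul (psub (sqnorm_from 0 p) (pconst (1/2))) Q) = 0) ->
       (forall Q, poly_deg_le n (d - 2) Q ->
          pE L (pmul (psub (sqnorm_from p (n - p)) (pconst (1/2))) Q) = 0) ->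
       pE L (Ppoly n m A B) <= normP + eps).
Proof.
  (* With [th = eps / 2] the entropy term is at most [eps / 2] as soon as [16 * ln n <= k * eps^2];
     the remaining factor 8 comes from [d <= 8 * k]. *)
  exists 128; split; [lra|].
  intros eps Heps n m d A B N Hn Hd HA HB HS [HN _] HK.
  destruct (half_degree d Hd) as (k & Hk1 & Hk2 & Hk3 & Hk4).
  assert (Pk : 0 < INR k) by (apply lt_0_INR; lia).
  assert (Err : eps / 2 + 4 * ln (INR n) / (eps / 2 * INR k) <= eps).
  { assert (H : 128 * ln (INR n) <= 8 * INR k * eps ^ 2).
    { apply (Rmult_le_compat_r (eps ^ 2)) in HK; [|nra].
      replace (128 * ln (INR n) / eps ^ 2 * eps ^ 2) with (128 * ln (INR n)) in HK by (field; lra).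
      apply (Rmult_le_compat_r (eps ^ 2)) in Hk4; [lra|nra]. }
    assert (4 * ln (INR n) / (eps / 2 * INR k) <= eps / 2); [|lra].
    apply Rmult_le_reg_r with (eps / 2 * INR k); [apply Rmult_lt_0_compat; lra|].
    replace (4 * ln (INR n) / (eps / 2 * INR k) * (eps / 2 * INR k)) with (4 * ln (INR n))
      by (field; lra).
    replace (eps / 2 * (eps / 2 * INR k)) with (INR k * eps ^ 2 / 4) by field; lra. }
  set (A' := fun i => symmetrize (A i)); set (B' := fun i => symmetrize (B i)).
  assert (A'_le1 : forall i v, (i < m)%nat -> 0 <= qf n (A' i) v /\ qf n (A' i) v <= sqn n v)
    by (intros; unfold A'; rewrite qf_symmetrize; auto).
  assert (B'_psd : forall i v, (i < m)%nat -> 0 <= qf n (B' i) v)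
    by (intros; unfold B'; rewrite qf_symmetrize; auto).
  assert (B'_sum : forall v, lsum (idx m) (fun i => qf n (B' i) v) <= sqn n v).
  { intros v; eapply Rle_trans; [|apply HS]; apply Req_le, lsum_ext; intros; apply qf_symmetrize. }
  assert (A'_sym : forall i, (i < m)%nat -> symm n (A' i)) by (intros; apply symm_symmetrize).
  assert (B'_sym : forall i, (i < m)%nat -> symm n (B' i)) by (intros; apply symm_symmetrize).
  destruct (sphere_bound n m A' B' N Hn A'_le1) as [N0 HP].
  { intros x Hx; apply HN; exists x; split; [exact Hx|]; rewrite peval_Ppoly; f_equal.
    apply lsum_ext; intros; unfold A', B'; rewrite !qf_symmetrize; reflexivity. }
  assert (EV : forall L, pE L (Ppoly n m A B) =
                 lsum (idx m) (fun i => mip n (A' i) (moment (reweight n L (B' i))))).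
  { intros L; rewrite pE_Ppoly; apply lsum_ext; intros i _; unfold A', B'.
    rewrite reweight_symmetrize, mip_symmetrize by apply symm_moment; reflexivity. }
  assert (mono_ok : forall a, mono_in n a -> (mdeg n a <= 2 * k)%nat -> poly_deg_le n (d - 2) [(1, a)])
    by (intros a Ha Da; apply poly_deg_le_single; [exact Ha|lia]).
  split.
  - intros L [L1 Lpos] Lc; rewrite EV.
    assert (Sc : scales n (2 * k) L delta 1).
    { intros a Ha Da; specialize (Lc _ (mono_ok a Ha Da)); unfold sqnorm in Lc.
      rewrite lsum_constraint in Lc; rewrite reweight_delta; lra. }
    (* Part (1) measures against [||X||^2 = 1], and the norm constraint also serves as the extra
       constraint. *)
    pose proof (completed_bound n m k A' B' delta delta 1 1 (3 * N) (eps / 2) L) as C.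
    enough (1 * lsum (idx m) (fun i => mip n (A' i) (moment (reweight n L (B' i)))) <=
            1 * (3 * N) + eps / 2 + 4 * ln (INR n) / (eps / 2 * INR k)) by lra.
    apply C; try assumption; try lra.
    + apply symm_delta.
    + intros v; rewrite qf_delta; apply B'_sum.
    + intros M Ms Mp _; apply rounding_single; auto.
      intros i Hi; repeat split; auto; intros v; [apply A'_le1|apply B'_psd]; exact Hi.
    + unfold sos_nonneg; rewrite Hk2; exact Lpos.
    + rewrite Rinv_1; exact Sc.
  - intros p Hp Alo Bhi L [L1 Lpos] Ly Lz; rewrite EV.
    assert (Slo : scales n (2 * k) L (delta_lo p) (1 / 2)).
    { intros a Ha Da; specialize (Ly _ (mono_ok a Ha Da)).
      rewrite lsum_constraint in Ly; rewrite reweight_delta_lo by exact Hp; lra. }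
    assert (Shi : scales n (2 * k) L (delta_hi p) (1 / 2)).
    { intros a Ha Da; specialize (Lz _ (mono_ok a Ha Da)).
      rewrite lsum_constraint in Lz; rewrite reweight_delta_hi by exact Hp; lra. }
    assert (Sc : scales n (2 * k) L delta 1).
    { intros a Ha Da; rewrite reweight_mip, mip_delta, <- (mip_delta_lo_hi n p), <- !reweight_mip.
      rewrite (Slo a Ha Da), (Shi a Ha Da); field. }
    assert (A'_lo : forall i j l, (i < m)%nat -> (p <= j \/ p <= l)%nat -> A' i j l = 0)
      by (intros; unfold A', symmetrize; rewrite !Alo by (assumption || lia); field).
    assert (B'_hi : forall i j l, (i < m)%nat -> (j < p \/ l < p)%nat -> B' i j l = 0)
      by (intros; unfold B', symmetrize; rewrite !Bhi by (assumption || lia); field).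
    (* Part (2) measures against [||Z||^2], whose value 1/2 gives [x = 2]; the extra constraint
       [||Y||^2 = 1/2] fixes the trace of the first block. *)
    pose proof (completed_bound n m k A' B' (delta_hi p) (delta_lo p) 2 (1 / 2) N (eps / 2) L) as C.
    enough (2 * lsum (idx m) (fun i => mip n (A' i) (moment (reweight n L (B' i)))) <=
            2 * N + eps / 2 + 4 * ln (INR n) / (eps / 2 * INR k)) by lra.
    apply C; try assumption; try lra.
    + apply symm_delta_hi.
    (* At the point [(0, v_Z)] the bound of the sum of the [B_i] by [||X||^2] becomes a bound by
       [||Z||^2]. *)
    + intros v; pose proof (B'_sum (splice p (fun _ => 0) v)) as H.
      rewrite sqn_splice, qf_0, Rplus_0_l in H.
      eapply Rle_trans; [|exact H]; apply Req_le, lsum_ext; intros i Hi; apply in_idx in Hi.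
      symmetry; apply qf_splice_hi; intros; apply B'_hi; assumption.
    + intros M Ms Mp ME.
      pose proof (rounding_bipartite n m p A' B' N A'_le1 B'_psd B'_sum A'_lo B'_hi HP M Ms Mp) as H.
      pose proof (mip_delta_lo_hi n p M) as Sp.
      (* Both blocks carry half of the trace, so the factor 4 of the bipartite bound is cancelled by
         1/2 times 1/2. *)
      replace (mip n (delta_hi p) M) with (1 / 2 * trace n M) in H by lra.
      rewrite ME in H; lra.
    + unfold sos_nonneg; rewrite Hk2; exact Lpos.
    + replace (/ 2) with (1 / 2) by field; exact Shi.
Qed.
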